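(* Let $A$ and $B$ be finitely generated groups with decidable word problem. Let $W$ be one of the following sets of words: $W=\{n_k\}$ for some $k\in\mathbb{N}$, $k\ge 1$ (the word defining the $k$-nilpotent product of groups), or $W=\{s_2\}$ (the word defining the $2$-solvable, i.e. metabelian, product of groups). Then in all these cases the verbal product $A\stackrel{w}{\ast}B$ relative to $W$ has decidable word problem.
   Context: Conventions: $[a,b]=aba^{-1}b^{-1}$. $F_\infty$ is the free group on countably many letters $\{x_i\}_{i\in\mathbb{N}}$; its elements are called words. Words: $n_1:=[x_2,x_1]$ and recursively $n_k:=[x_{k+1},n_{k-1}]$ for $k\ge 2$; and $s_1(x_1,x_2):=[x_1,x_2]$, $s_k(x_1,\ldots,x_{2^k}):=[s_{k-1}(x_1,\ldots,x_{2^{k-1}}),\,s_{k-1}(x_{2^{k-1}+1},\ldots,x_{2^k})]$ for $k\ge 2$. Verbal subgroup: for a group $G$ and a nonempty set $W\subseteq F_\infty$, $W(G)$ is the subgroup of $G$ generated by all evaluations of the words of $W$ at elements of $G$. (For $W=\{n_k\}$ this is the $(k+1)$-st term of the lower central series of $G$, where the first term is $G$; for $W=\{s_k\}$ it is the $k$-th derived subgroup $G^{(k)}$.) Verbal product: for groups $A,B$, let $[A,B]$ be the subgroup of the free product $A\ast B$ generated by the elements $[a,b]$ with $a\in A$, $b\in B$ (it is normal in $A\ast B$). The verbal product of $A$ and $B$ relative to $W$ is $A\stackrel{w}{\ast}B:=(A\ast B)/\bigl(W(A\ast B)\cap[A,B]\bigr)$. For $W=\{n_k\}$ it is called the $k$-nilpotent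 product and for $W=\{s_k\}$ the $k$-solvable product. Word problem: a group $G=\langle x_1,\ldots,x_n\mid R\rangle$ generated by finitely many elements has decidable word problem if there is an algorithm which, given as input a word $w$ in the free group $F_n$ on $x_1,\ldots,x_n$, returns $1$ if $w=1$ in $G$ and $0$ if not. *)

(* Defs.v *)
From HB Require Import structures.
From mathcomp Require Import all_boot.
From mathcomp Require Import boolp classical_sets.

Set Implicit Arguments.
Unset Strict Implicit.
Unset Printing Implicit Defensive.

Local Open Scope classical_set_scope.

(* Syntax of the partial recursive functions of [n] arguments (Kleene). *)
Inductive recfun : nat -> Type :=
| RZero n : recfun n
| RSucc : recfun 1
| RProj n (i : 'I_n) : recfun n
| RComp m n (f : recfun m) (g : 'I_m -> recfun n) : recfun n
| RPrec n (f : recfun n) (g : recfun n.+2) : recfun n.+1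
| RMin n (f : recfun n.+1) : recfun n.

(* [rec_graph f v y]: the partial function described by [f] is defined at [v]
   and has value [y].  Primitive recursion is on the first argument,
   h(0, v) = f(v) and h(k+1, v) = g(k, h(k, v), v); minimisation looks for the
   least y with f(y, v) = 0, all previous values being defined and nonzero. *)
Fixpoint rec_graph n (f : recfun n) : n.-tuple nat -> nat -> Prop :=
  match f in recfun n return n.-tuple nat -> nat -> Prop with
  | RZero _ => fun _ y => y = 0
  | RSucc => fun v y => y = (thead v).+1
  | RProj _ i => fun v y => y = tnth v i
  | RComp m _ f g => fun v y =>
      exists2 w : m.-tuple nat,
        forall i, rec_graph (g i) v (tnth w i) & rec_graph f w y
  | RPrec _ f g => fun v y =>
      exists h : nat -> nat,
        [/\ rec_graph f [tuple of behead v] (h 0),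
            forall k, k < thead v ->
              rec_graph g [tuple of k :: h k :: behead v] (h k.+1)
          & y = h (thead v)]
  | RMin _ f => fun v y =>
      rec_graph f [tuple of y :: v] 0 /\
      forall k, k < y -> exists z, rec_graph f [tuple of k :: v] z.+1
  end.

(* Elements of the free group on [X] are represented by words, not necessarily
   reduced, in the letters x = (x, false) and x^-1 = (x, true). *)
Definition word (X : Type) := seq (X * bool).

Definition word_inv X (w : word X) : word X :=
  rev [seq (l.1, ~~ l.2) | l <- w].

Definition word_comm X (u v : word X) : word X :=
  u ++ v ++ word_inv u ++ word_inv v.

(* The letters of F_oo are numbered from 1, the index 0 is not used below.
   With n_0 = x_1 the recursion n_k = [x_(k+1), n_(k-1)] also gives n_1. *)
Fixpoint nil_word (k : nat) : word nat :=
  if k is j.+1 then word_comm [:: (k.+1, false)] (nil_word j)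
  else [:: (1, false)].

(* [sol_word_from i k] is s_k(x_i, ..., x_(i + 2^k - 1)), with s_0(x) = x. *)
Fixpoint sol_word_from (i k : nat) : word nat :=
  if k is j.+1 then
    word_comm (sol_word_from i j) (sol_word_from (i + 2 ^ j) j)
  else [:: (i, false)].

Definition sol_word (k : nat) : word nat := sol_word_from 1 k.

Local Open Scope group_scope.
Local Open Scope quotient_scope.

Definition letter_eval X (G : groupType) (x : X -> G) (l : X * bool) : G :=
  if l.2 then (x l.1)^-1 else x l.1.

Definition word_eval X (G : groupType) (x : X -> G) (w : word X) : G :=
  \prod_(l <- w) letter_eval x l.

(* Not MathComp's [~ x, y], which is x^-1 * y^-1 * x * y. *)
Definition comm (G : groupType) (x y : G) : G := x * y * x^-1 * y^-1.

Definition is_subgroup (G : groupType) (H : set G) : Prop :=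
  [/\ H 1, forall x y, H x -> H y -> H (x * y) & forall x, H x -> H x^-1].

Definition is_normal (G : groupType) (N : set G) : Prop :=
  is_subgroup N /\ forall g x, N x -> N (g * x * g^-1).

Definition generated (G : groupType) (S : set G) : set G :=
  smallest (@is_subgroup G) S.

Definition verbal_subgroup (W : set (word nat)) (G : groupType) : set G :=
  generated [set x | exists2 w, W w & exists g : nat -> G, x = word_eval g w].

Arguments verbal_subgroup : clear implicits.

Definition letter_code n (l : 'I_n * bool) : nat :=
  ((l.1).*2 + l.2)%N.

(* [CodeSeq.code] is MathComp's bijection from [seq nat] to [nat],
   [:: a1; a2; ...] |-> 2 ^ a1 * (1 + 2 * (code of [:: a2; ...])), with
   code of [::] equal to 0. *)
Definition word_code n (w : word 'I_n) : nat :=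
  CodeSeq.code [seq letter_code l | l <- w].

(* The algorithm has to halt on every word, with output 1 or 0. *)
Definition decidable_word_problem (G : groupType) : Prop :=
  exists (n : nat) (x : 'I_n -> G),
    generated (range x) = setT /\
    exists f : recfun 1, forall w : word 'I_n,
      rec_graph f [tuple word_code w] (nat_of_bool (word_eval x w == 1)).

Record normalSubgroup (G : groupType) := NormalSubgroup {
  nsg_set : set G;
  nsg_normal : is_normal nsg_set
}.

Section Quotient.
Variables (G : groupType) (N : normalSubgroup G).

Definition coset_rel : rel G := fun x y => `[< nsg_set N (x^-1 * y) >].

Lemma coset_rel_equiv : equiv_class_of coset_rel.
Proof.
have [[N1 NM NV] _] := nsg_normal N.
split=> [x|x y|y x z].
- by apply/asboolP; rewrite mulVg.
- by apply/asboolP/asboolP => /NV; rewrite invgM invgK.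
- move=> /asboolP xy /asboolP yz; apply/asboolP.
  by have := NM _ _ xy yz; rewrite mulgA mulgK.
Qed.

Canonical coset_equiv := EquivRelPack coset_rel_equiv.

Definition quotient_group : Type := {eq_quot coset_equiv}.

HB.instance Definition _ := Choice.on quotient_group.
HB.instance Definition _ := EqQuotient.on quotient_group.

Implicit Types p q : quotient_group.

Definition quotient_proj (x : G) : quotient_group := \pi_quotient_group x.

Definition quotient_one : quotient_group := quotient_proj 1.
Definition quotient_mul p q : quotient_group := quotient_proj (repr p * repr q).
Definition quotient_inv p : quotient_group := quotient_proj (repr p)^-1.

Lemma quotient_projP x y : quotient_proj x = quotient_proj y <-> nsg_set N (x^-1 * y).
Proof.
split=> [/eqP|Nxy]; first by rewrite eqquotE => /asboolP.
by apply/eqP; rewrite eqquotE; apply/asboolP.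
Qed.

Lemma quotient_reprK p : quotient_proj (repr p) = p.
Proof. exact: reprK. Qed.

Lemma quotient_repr x : nsg_set N ((repr (quotient_proj x))^-1 * x).
Proof. by apply/quotient_projP; rewrite quotient_reprK. Qed.

Lemma quotient_projM x y :
  quotient_mul (quotient_proj x) (quotient_proj y) = quotient_proj (x * y).
Proof.
apply/quotient_projP; have [[_ NM NV] NJ] := nsg_normal N.
have Nx := quotient_repr x; have Ny := quotient_repr y.
move: (repr (quotient_proj x)) (repr (quotient_proj y)) Nx Ny => x' y' Nx Ny.
have := NM _ _ (NJ y'^-1 _ Nx) Ny.
by rewrite invgM invgK !mulgA mulgK.
Qed.

Lemma quotient_projV x : quotient_inv (quotient_proj x) = quotient_proj x^-1.
Proof.
apply/quotient_projP; have [[_ NM NV] NJ] := nsg_normal N.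
have Nx := NJ x _ (NV _ (quotient_repr x)); move: (repr _) Nx => x' Nx.
by move: Nx; rewrite invgM !invgK !mulgA mulgV mul1g.
Qed.

Lemma quotient_mulA : associative quotient_mul.
Proof.
move=> p q r; rewrite -(quotient_reprK p) -(quotient_reprK q).
by rewrite -(quotient_reprK r) !quotient_projM mulgA.
Qed.

Lemma quotient_mul1g : left_id quotient_one quotient_mul.
Proof. by move=> p; rewrite -(quotient_reprK p) quotient_projM mul1g. Qed.

Lemma quotient_mulg1 : right_id quotient_one quotient_mul.
Proof. by move=> p; rewrite -(quotient_reprK p) quotient_projM mulg1. Qed.

Lemma quotient_mulVg : left_inverse quotient_one quotient_inv quotient_mul.
Proof.
move=> p; rewrite -(quotient_reprK p) quotient_projV quotient_projM.
by rewrite mulVg.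
Qed.

Lemma quotient_mulgV : right_inverse quotient_one quotient_inv quotient_mul.
Proof.
move=> p; rewrite -(quotient_reprK p) quotient_projV quotient_projM.
by rewrite mulgV.
Qed.

HB.instance Definition _ := isGroup.Build quotient_group quotient_mulA
  quotient_mul1g quotient_mulg1 quotient_mulVg quotient_mulgV.

End Quotient.

Section FreeProduct.
Variables A B : groupType.

(* Words over the disjoint union of [A] and [B], modulo the congruence that
   multiplies adjacent letters of the same factor and deletes the units. *)
Inductive fp_equiv : seq (A + B) -> seq (A + B) -> Prop :=
| fp_refl s : fp_equiv s s
| fp_sym s t : fp_equiv s t -> fp_equiv t s
| fp_trans s t u : fp_equiv s t -> fp_equiv t u -> fp_equiv s u
| fp_cat s s' t t' :
    fp_equiv s s' -> fp_equiv t t' -> fp_equiv (s ++ t) (s' ++ t')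
| fp_mull a a' : fp_equiv [:: inl a; inl a'] [:: inl (a * a')]
| fp_mulr b b' : fp_equiv [:: inr b; inr b'] [:: inr (b * b')]
| fp_onel : fp_equiv [:: inl 1] [::]
| fp_oner : fp_equiv [:: inr 1] [::].

Definition fp_rel : rel (seq (A + B)) := fun s t => `[< fp_equiv s t >].

Lemma fp_rel_equiv : equiv_class_of fp_rel.
Proof.
split=> [s|s t|t s u].
- exact/asboolP/fp_refl.
- by apply/asboolP/asboolP; apply: fp_sym.
- by move=> /asboolP st /asboolP tu; apply/asboolP; apply: fp_trans st tu.
Qed.

Canonical fp_equivRel := EquivRelPack fp_rel_equiv.

Definition free_product : Type := {eq_quot fp_equivRel}.

HB.instance Definition _ := Choice.on free_product.
HB.instance Definition _ := EqQuotient.on free_product.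

Implicit Types p q : free_product.

Definition fp_proj (s : seq (A + B)) : free_product := \pi_free_product s.

Definition fp_letter_inv (l : A + B) : A + B :=
  match l with inl a => inl a^-1 | inr b => inr b^-1 end.

Definition fp_word_inv (s : seq (A + B)) : seq (A + B) :=
  rev (map fp_letter_inv s).

Definition fp_one : free_product := fp_proj [::].
Definition fp_mul p q : free_product := fp_proj (repr p ++ repr q).
Definition fp_inv p : free_product := fp_proj (fp_word_inv (repr p)).

Lemma fp_projP s t : fp_proj s = fp_proj t <-> fp_equiv s t.
Proof.
split=> [/eqP|st]; first by rewrite eqquotE => /asboolP.
by apply/eqP; rewrite eqquotE; apply/asboolP.
Qed.

Lemma fp_reprK p : fp_proj (repr p) = p.
Proof. exact: reprK. Qed.

Lemma fp_repr s : fp_equiv (repr (fp_proj s)) s.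
Proof. by apply/fp_projP; rewrite fp_reprK. Qed.

Lemma fp_projM s t : fp_mul (fp_proj s) (fp_proj t) = fp_proj (s ++ t).
Proof. by apply/fp_projP/fp_cat; apply: fp_repr. Qed.

Lemma fp_word_inv_equiv s t :
  fp_equiv s t -> fp_equiv (fp_word_inv s) (fp_word_inv t).
Proof.
elim=> {s t} [s|s t _|s t u _ + _|s s' t t' _ IHs _ IHt|a a'|b b'||].
- exact: fp_refl.
- exact: fp_sym.
- exact: fp_trans.
- by rewrite /fp_word_inv !map_cat !rev_cat; apply: fp_cat.
- by rewrite /fp_word_inv /= invgM; apply: fp_mull.
- by rewrite /fp_word_inv /= invgM; apply: fp_mulr.
- by rewrite /fp_word_inv /= invg1; apply: fp_onel.
- by rewrite /fp_word_inv /= invg1; apply: fp_oner.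
Qed.

Lemma fp_projV s : fp_inv (fp_proj s) = fp_proj (fp_word_inv s).
Proof. by apply/fp_projP/fp_word_inv_equiv; apply: fp_repr. Qed.

Lemma fp_word_mulV s : fp_equiv (s ++ fp_word_inv s) [::].
Proof.
elim: s => [|l s IHs]; first exact: fp_refl.
rewrite /fp_word_inv /= rev_cons -cats1 catA.
rewrite -[_ :: _]/([:: l] ++ ((s ++ fp_word_inv s) ++ [:: fp_letter_inv l])).
have step : fp_equiv ((s ++ fp_word_inv s) ++ [:: fp_letter_inv l])
                     [:: fp_letter_inv l].
  exact: (fp_cat IHs (fp_refl _)).
apply: fp_trans (fp_cat (fp_refl [:: l]) step) _.
case: l {step} => c /=.
- by apply: fp_trans (fp_mull _ _) _; rewrite mulgV; apply: fp_onel.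
- by apply: fp_trans (fp_mulr _ _) _; rewrite mulgV; apply: fp_oner.
Qed.

Lemma fp_word_invK : involutive fp_word_inv.
Proof.
move=> s; rewrite /fp_word_inv map_rev revK -map_comp -[RHS]map_id.
by apply: eq_map => -[] c /=; rewrite invgK.
Qed.

Lemma fp_mulA : associative fp_mul.
Proof.
move=> p q r; rewrite -(fp_reprK p) -(fp_reprK q) -(fp_reprK r).
by rewrite !fp_projM catA.
Qed.

Lemma fp_mul1g : left_id fp_one fp_mul.
Proof. by move=> p; rewrite -(fp_reprK p) fp_projM. Qed.

Lemma fp_mulg1 : right_id fp_one fp_mul.
Proof. by move=> p; rewrite -(fp_reprK p) fp_projM cats0. Qed.

Lemma fp_mulgV : right_inverse fp_one fp_inv fp_mul.
Proof.
move=> p; rewrite -(fp_reprK p) fp_projV fp_projM.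
exact/fp_projP/fp_word_mulV.
Qed.

Lemma fp_mulVg : left_inverse fp_one fp_inv fp_mul.
Proof.
move=> p; rewrite -(fp_reprK p) fp_projV fp_projM; apply/fp_projP.
by rewrite -{2}[repr p]fp_word_invK; apply: fp_word_mulV.
Qed.

HB.instance Definition _ := isGroup.Build free_product fp_mulA
  fp_mul1g fp_mulg1 fp_mulVg fp_mulgV.

Definition fp_inl (a : A) : free_product := fp_proj [:: inl a].
Definition fp_inr (b : B) : free_product := fp_proj [:: inr b].

End FreeProduct.

Lemma generated_subgroup (G : groupType) (S : set G) :
  is_subgroup (generated S).
Proof.
split=> [H [[] //]|x y Sx Sy H HS|x Sx H HS]; have [[H1 HM HV] _] := HS.
- by apply: HM; [apply: Sx | apply: Sy].
- by apply: HV; apply: Sx.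
Qed.

Lemma generated_conj (G : groupType) (S : set G) (g : G) :
  (forall s, S s -> generated S (g * s * g^-1)) ->
  forall x, generated S x -> generated S (g * x * g^-1).
Proof.
move=> Sg x Sx; have [S1 SM SV] := generated_subgroup S.
apply: (Sx [set y | generated S (g * y * g^-1)]); split=> //.
split=> [|y z Sy Sz|y Sy] /=.
- by rewrite mulg1 mulgV.
- by have := SM _ _ Sy Sz; rewrite !mulgA mulgVK.
- by have := SV _ Sy; rewrite !invgM invgK mulgA.
Qed.

Lemma word_eval_conj X (G : groupType) (x : X -> G) (g : G) (w : word X) :
  word_eval (fun i => g * x i * g^-1) w = g * word_eval x w * g^-1.
Proof.
rewrite /word_eval; elim: w => [|[i b] w IHw].
  by rewrite !big_nil mulg1 mulgV.
rewrite !big_cons IHw !mulgA /letter_eval; congr (_ * _ * _).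
by case: b => /=; rewrite ?invgM ?invgK ?mulgA mulgVK.
Qed.

Lemma verbal_subgroup_normal (W : set (word nat)) (G : groupType) :
  is_normal (verbal_subgroup W G).
Proof.
split=> [|g]; first exact: generated_subgroup.
apply: generated_conj => _ [w Ww [x ->]] H [_ SH]; apply: SH.
by exists w => //; exists (fun i => g * x i * g^-1); rewrite word_eval_conj.
Qed.

Section VerbalProduct.
Variables (W : set (word nat)) (A B : groupType).
Local Notation P := (free_product A B).

Definition cross_commutators : set P :=
  generated [set x | exists a b, x = comm (fp_inl B a) (fp_inr A b)].

Lemma cross_commutators_normal : is_normal cross_commutators.
Proof.
split; first exact: generated_subgroup.
have [C1 CM CV] := generated_subgroup
  [set x : P | exists a b, x = comm (fp_inl B a) (fp_inr A b)].
have mem a b : cross_commutators (comm (fp_inl B a) (fp_inr A b)).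
  by move=> H [_ SH]; apply: SH; exists a, b.
have inlM a a' : fp_inl B (a * a') = fp_inl B a * fp_inl B a'.
  by rewrite [RHS]fp_projM; apply/fp_projP/fp_sym/fp_mull.
have inrM b b' : fp_inr A (b * b') = fp_inr A b * fp_inr A b'.
  by rewrite [RHS]fp_projM; apply/fp_projP/fp_sym/fp_mulr.
pose stable g := forall x, cross_commutators x -> cross_commutators (g * x * g^-1).
have stableM g h : stable g -> stable h -> stable (g * h).
  by move=> Sg Sh x /Sh/Sg; rewrite invgM !mulgA.
have stable_inl a : stable (fp_inl B a).
  apply: generated_conj => _ [a' [b ->]].
  have := CM _ _ (mem (a * a') b) (CV _ (mem a b)).
  by rewrite /comm inlM !invgM !invgK !mulgA !mulgVK.
have stable_inr b : stable (fp_inr A b).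
  apply: generated_conj => _ [a [b' ->]].
  have := CM _ _ (CV _ (mem a b)) (mem a (b * b')).
  by rewrite /comm inrM !invgM !invgK !mulgA !mulgVK.
move=> g; rewrite -(fp_reprK g); elim: (repr g) => [|l s IHs].
  by move=> x; rewrite -[fp_proj _]/(1 : P) mul1g invg1 mulg1.
have -> : fp_proj (l :: s) = fp_proj [:: l] * fp_proj s by rewrite [RHS]fp_projM.
by apply: stableM => //; case: l.
Qed.

Lemma verbal_kernel_normal :
  is_normal (verbal_subgroup W P `&` cross_commutators).
Proof.
have [[V1 VM VV] VJ] := verbal_subgroup_normal W P.
have [[C1 CM CV] CJ] := cross_commutators_normal.
split=> [|g x [Vx Cx]]; last by split; [apply: VJ | apply: CJ].
split=> [|x y [Vx Cx] [Vy Cy]|x [Vx Cx]]; first by split.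
- by split; [apply: VM | apply: CM].
- by split; [apply: VV | apply: CV].
Qed.

Definition verbal_product : groupType :=
  quotient_group (NormalSubgroup verbal_kernel_normal).

End VerbalProduct.

(* Main.v *)
(* Let P = A * B. A word is trivial in the verbal product iff it is trivial in A,
   in B and in Q = P / W(P), because [A, B] is the kernel of P -> A x B. So only
   the finitely generated group Q matters, which is nilpotent or metabelian,
   and the algorithm may depend on finitely many unknown data of Q.

   If the word problem is decidable for a family x and t normalises <x>
   computably, it is decidable for the family t, x: bring every word to the form
   u t^e with u in <x>; the e with t^e in <x> are the multiples of one number.
   A nilpotent group is obtained from 1 by such steps, adjoining the iterated
   commutators of the generators by decreasing weight.

   A metabelian group is obtained in the same way from the abelian normal
   subgroup generated by the conjugates of the commutators [a, b] of generators,
   a finitely generated module over a polynomial ring over Z. Its monomials are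
   numbered by positive integers, multiplication by a variable being
   multiplication by a prime; a finite strong Groebner basis, which exists by
   Dickson's lemma, then decides equality by reduction. *)
Require Import Defs.
From mathcomp Require Import all_boot.
From mathcomp Require Import boolp classical_sets.

Set Implicit Arguments.
Unset Strict Implicit.
Unset Printing Implicit Defensive.

(** * Computable functions *)

Definition recn n (F : n.-tuple nat -> nat) : Prop :=
  exists f : recfun n, forall v, rec_graph f v (F v).

Lemma eq_recn n (F F' : n.-tuple nat -> nat) : F =1 F' -> recn F -> recn F'.
Proof. by move=> eqF [f Hf]; exists f => v; rewrite -eqF. Qed.

Lemma recn_proj n (i : 'I_n) : recn (fun v => tnth v i).
Proof. by exists (RProj i). Qed.

Lemma recn_comp m n (F : m.-tuple nat -> nat) (G : 'I_m -> n.-tuple nat -> nat) :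
  recn F -> (forall i, recn (G i)) ->
  recn (fun v => F [tuple G i v | i < m]).
Proof.
move=> [f Hf] /choice[g Hg]; exists (RComp f g) => v /=.
by exists [tuple G i v | i < m] => // i; rewrite tnth_mktuple.
Qed.

Lemma recn_prec n (F : n.-tuple nat -> nat) (G : n.+2.-tuple nat -> nat) :
  recn F -> recn G ->
  recn (fun v : n.+1.-tuple nat => nat_rect (fun=> nat)
    (F [tuple of behead v])
    (fun k h => G [tuple of k :: h :: behead v]) (thead v)).
Proof.
move=> [f Hf] [g Hg]; exists (RPrec f g) => v /=.
by exists (nat_rect (fun=> nat) (F [tuple of behead v])
  (fun k h => G [tuple of k :: h :: behead v])); split.
Qed.

(** Minimisation stays total because its result is supplied in advance as the function [mu]. *)
Lemma recn_min n (F : n.+1.-tuple nat -> nat) (mu : n.-tuple nat -> nat) :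
  recn F -> (forall v, F [tuple of mu v :: v] = 0) ->
  (forall v k, k < mu v -> 0 < F [tuple of k :: v]) -> recn mu.
Proof.
move=> [f Hf] F0 Fpos; exists (RMin f) => v /=; split; first by rewrite -(F0 v).
by move=> k /Fpos; exists (F [tuple of k :: v]).-1; rewrite prednK.
Qed.

Definition rec1 (F : nat -> nat) := recn (fun v : 1.-tuple nat => F (thead v)).
Definition rec2 (F : nat -> nat -> nat) :=
  recn (fun v : 2.-tuple nat => F (tnth v ord0) (tnth v (lift ord0 ord0))).
Definition rec3 (F : nat -> nat -> nat -> nat) :=
  recn (fun v : 3.-tuple nat => F (tnth v ord0) (tnth v (lift ord0 ord0))
    (tnth v (lift ord0 (lift ord0 ord0)))).

Lemma recn_comp1 n F (G : n.-tuple nat -> nat) :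
  rec1 F -> recn G -> recn (fun v => F (G v)).
Proof.
move=> rF rG; apply: eq_recn (recn_comp (G := fun=> G) rF _) => // v.
by rewrite /thead tnth_mktuple.
Qed.

Lemma recn_comp2 n F (G H : n.-tuple nat -> nat) :
  rec2 F -> recn G -> recn H -> recn (fun v => F (G v) (H v)).
Proof.
move=> rF rG rH.
apply: eq_recn (recn_comp (G := fun i : 'I_2 => if i == ord0 then G else H) rF _).
  by move=> v; rewrite !tnth_mktuple.
by move=> i; case: ifP.
Qed.

Lemma rec1_id : rec1 id. Proof. exact: recn_proj. Qed.

Lemma rec1_succ : rec1 succn. Proof. by exists RSucc. Qed.

Lemma recn_const n c : recn (fun _ : n.-tuple nat => c).
Proof.
elim: c => [|c IHc]; first by exists (RZero n).
exact: (recn_comp1 rec1_succ IHc).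
Qed.

Lemma rec2_prec (f : nat -> nat) (g : nat -> nat -> nat -> nat) :
  rec1 f -> rec3 g ->
  rec2 (fun k x => nat_rect (fun=> nat) (f x) (fun i h => g i h x) k).
Proof.
move=> rf rg; apply: eq_recn (recn_prec rf rg) => v.
case/tupleP: v => k v; case/tupleP: v => x v; rewrite !(tnth_nth 0) /= theadE.
by elim: k => //= k ->.
Qed.

Lemma rec1_prec c (g : nat -> nat -> nat) :
  rec2 g -> rec1 (fun k => nat_rect (fun=> nat) c g k).
Proof.
move=> rg; have r := @rec2_prec (fun=> c) (fun i h _ => g i h) (recn_const _ _).
have rk : rec2 (fun k _ => nat_rect (fun=> nat) c g k).
  by apply: r; exact: (recn_comp2 rg (recn_proj _) (recn_proj _)).
exact: (recn_comp2 rk rec1_id rec1_id).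
Qed.

Lemma rec2_flip F : rec2 F -> rec2 (fun x y => F y x).
Proof. by move=> rF; apply: (recn_comp2 rF (recn_proj _) (recn_proj _)). Qed.

Lemma eq_rec1 F F' : F =1 F' -> rec1 F -> rec1 F'.
Proof. by move=> eqF; apply: eq_recn => v; apply: eqF. Qed.

Lemma eq_rec2 F F' : F =2 F' -> rec2 F -> rec2 F'.
Proof. by move=> eqF; apply: eq_recn => v; apply: eqF. Qed.

Lemma rec2_add : rec2 addn.
Proof.
have r := rec2_prec (g := fun _ h _ => h.+1) rec1_id
  (recn_comp1 rec1_succ (recn_proj _)).
by apply: eq_rec2 r => k x; elim: k => //= k ->.
Qed.

Lemma rec2_mul : rec2 muln.
Proof.
have r := rec2_prec (f := fun=> 0) (g := fun _ h x => x + h) (recn_const _ 0)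
  (recn_comp2 rec2_add (recn_proj _) (recn_proj _)).
by apply: eq_rec2 r => k x; elim: k => //= k ->.
Qed.

Lemma rec1_pred : rec1 predn.
Proof. by apply: eq_rec1 (rec1_prec 0 (g := fun i _ => i) (recn_proj _)) => -[]. Qed.

Lemma rec2_sub : rec2 subn.
Proof.
have r := rec2_prec (g := fun _ h _ => h.-1) rec1_id
  (recn_comp1 rec1_pred (recn_proj _)).
apply: eq_rec2 (rec2_flip r) => x k.
by elim: k => [|k IHk]; rewrite ?subn0 ?subnS -?IHk.
Qed.

Lemma rec1_exp2 : rec1 (expn 2).
Proof.
have r := rec1_prec 1 (g := fun _ h => h + h)
  (recn_comp2 rec2_add (recn_proj _) (recn_proj _)).
by apply: eq_rec1 r; elim=> //= k ->; rewrite expnS mul2n addnn.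
Qed.

Lemma rec1_odd : rec1 (fun n => odd n).
Proof.
have r := rec1_prec 0 (g := fun _ h => 1 - h)
  (recn_comp2 rec2_sub (recn_const _ 1) (recn_proj _)).
by apply: eq_rec1 r; elim=> //= k ->; case: (odd k).
Qed.

Lemma rec1_half : rec1 half.
Proof.
have r := rec1_prec 0 (g := fun i h => odd i + h)
  (recn_comp2 rec2_add (recn_comp1 rec1_odd (recn_proj _)) (recn_proj _)).
by apply: eq_rec1 r; elim=> //= k ->; rewrite uphalf_half.
Qed.

(* Pairing with this function as cons is CodeSeq.code on lists of naturals. *)
Definition npair (a b : nat) : nat := 2 ^ a * b.*2.+1.
Definition nfst (n : nat) : nat := logn 2 n.
Definition nsnd (n : nat) : nat := (iter (nfst n) half n)./2.

Lemma half_iter_pow2 a m : iter a half (2 ^ a * m) = m.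
Proof.
elim: a => [|a IHa]; first by rewrite mul1n.
by rewrite iterSr expnS -mulnA mul2n doubleK.
Qed.

Lemma npairK1 a b : nfst (npair a b) = a.
Proof.
rewrite /nfst /npair lognM ?expn_gt0 // pfactorK //.
by rewrite lognE /= dvdn2 /= odd_double addn0.
Qed.

Lemma npairK2 a b : nsnd (npair a b) = b.
Proof. by rewrite /nsnd npairK1 half_iter_pow2 /= uphalf_double. Qed.

Lemma rec2_iter f : rec1 f -> rec2 (fun k n => iter k f n).
Proof.
move=> rf; have r := rec2_prec (g := fun _ h _ => f h) rec1_id
  (recn_comp1 rf (recn_proj _)).
by apply: eq_rec2 r => k x; elim: k => //= k ->.
Qed.

Lemma rec2_npair : rec2 npair.
Proof.
have r : rec2 (fun a b => 2 ^ a * (b + b).+1).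
  apply: (recn_comp2 rec2_mul (recn_comp1 rec1_exp2 (recn_proj _))).
  apply: (recn_comp1 rec1_succ).
  exact: (recn_comp2 rec2_add (recn_proj _) (recn_proj _)).
by apply: eq_rec2 r => a b; rewrite addnn.
Qed.

Lemma npair_surj n : 0 < n -> exists a b, n = npair a b.
Proof.
move=> n0; have [m cop En] := pfactor_coprime (isT : prime 2) n0.
exists (logn 2 n), m./2; rewrite {1}En /npair mulnC; congr (_ * _).
by rewrite -[LHS]odd_double_half; move: cop; rewrite coprime2n => ->.
Qed.

(** The 2-adic valuation is found by minimisation, as the first [k] for which n/2^k is odd. The term
    [1 - (1 - n)] is the sign of [n]: at [n = 0] the search stops at once, with the value 0 that
    [logn] has there. *)
Lemma rec1_nfst : rec1 nfst.
Proof.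
pose F k n := (1 - (1 - n)) - odd (iter k half n).
have rF : rec2 F.
  apply: (recn_comp2 rec2_sub).
    apply: (recn_comp2 rec2_sub (recn_const _ 1)).
    exact: (recn_comp2 rec2_sub (recn_const _ 1) (recn_proj _)).
  exact: (recn_comp1 rec1_odd (rec2_iter rec1_half)).
apply: (recn_min rF) => v; case/tupleP: v => n v.
  rewrite !(tnth_nth 0) /= theadE.
  case: (posnP n) => [->|/npair_surj[a [b ->]]]; first by rewrite /F sub0n.
  by apply/eqP; rewrite /F npairK1 half_iter_pow2 subn_eq0 oddS odd_double leq_subr.
move=> k; rewrite !(tnth_nth 0) /= theadE.
case: (posnP n) => [->|/npair_surj[a [b ->]]]; first by rewrite /nfst logn0.
rewrite npairK1 => ka; rewrite /F.
have -> : odd (iter k half (npair a b)) = false.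
  rewrite /npair -(subnKC (ltnW ka)) expnD -mulnA half_iter_pow2 oddM oddX.
  by rewrite subn_eq0 leqNgt ka.
by rewrite subn0 subn_gt0 (eqP (_ : 1 - npair a b == 0)) // subn_eq0 muln_gt0 expn_gt0.
Qed.

Lemma rec1_nsnd : rec1 nsnd.
Proof.
apply: (recn_comp1 rec1_half); apply: (recn_comp2 (rec2_iter rec1_half)).
  exact: rec1_nfst.
exact: rec1_id.
Qed.

Lemma rec1_comp F G : rec1 F -> rec1 G -> rec1 (fun n => F (G n)).
Proof. exact: recn_comp1. Qed.

Lemma rec1_npair F G : rec1 F -> rec1 G -> rec1 (fun n => npair (F n) (G n)).
Proof. exact: (recn_comp2 rec2_npair). Qed.

(** Parameter, counter and accumulator are packed into one number, so that the recursions below only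
    involve functions of one argument. *)
Lemma rec1_rec f g K Z :
  rec1 f -> rec1 g -> rec1 K -> rec1 Z ->
  rec1 (fun n => nat_rect (fun=> nat) (f (Z n))
         (fun i h => g (npair (Z n) (npair i h))) (K n)).
Proof.
move=> rf rg rK rZ; have r3 : rec3 (fun i h x => g (npair x (npair i h))).
  apply: (recn_comp1 rg); apply: (recn_comp2 rec2_npair (recn_proj _)).
  exact: (recn_comp2 rec2_npair (recn_proj _) (recn_proj _)).
exact: (recn_comp2 (rec2_prec rf r3) rK rZ).
Qed.

(** * Encoded data types and computable functions between them *)

Class encoding (T : Type) := enc : T -> nat.

#[global] Instance nat_encoding : encoding nat := id.
#[global] Instance bool_encoding : encoding bool := nat_of_bool.
#[global] Instance prod_encoding T U (eT : encoding T) (eU : encoding U) :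
  encoding (T * U) := fun p => npair (enc p.1) (enc p.2).
#[global] Instance seq_encoding T (eT : encoding T) : encoding (seq T) :=
  foldr (fun x n => npair (enc x) n) 0.

(** The numerical function is prescribed only at codes; elsewhere it is total but arbitrary. *)
Definition computable T U {eT : encoding T} {eU : encoding U} (f : T -> U) :=
  exists2 F, rec1 F & forall x, F (enc x) = enc (f x).

Section Computable.
Context {C T U : Type}.
Context {eC : encoding C} {eT : encoding T} {eU : encoding U}.

Lemma eq_computable (f g : T -> U) : f =1 g -> computable f -> computable g.
Proof. by move=> fg [F rF HF]; exists F => // x; rewrite -fg. Qed.

Lemma computable_id : computable (fun x : T => x).
Proof. by exists id; first exact: rec1_id. Qed.

Lemma computable_comp (g : T -> U) (f : C -> T) :
  computable g -> computable f -> computable (fun x => g (f x)).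
Proof.
move=> [G rG HG] [F rF HF]; exists (fun n => G (F n)); first exact: rec1_comp.
by move=> x; rewrite HF HG.
Qed.

Lemma computable_const (c : U) : computable (fun _ : T => c).
Proof. by exists (fun=> enc c); first exact: recn_const. Qed.

Lemma computable_pair (f : C -> T) (g : C -> U) :
  computable f -> computable g -> computable (fun x => (f x, g x)).
Proof.
move=> [F rF HF] [G rG HG]; exists (fun n => npair (F n) (G n)).
  exact: rec1_npair.
by move=> x; rewrite HF HG.
Qed.

Lemma computable_fst (f : C -> T * U) :
  computable f -> computable (fun x => (f x).1).
Proof.
move=> [F rF HF]; exists (fun n => nfst (F n)); first exact: rec1_comp rec1_nfst rF.
by move=> x; rewrite HF; apply: npairK1.
Qed.

Lemma computable_snd (f : C -> T * U) :
  computable f -> computable (fun x => (f x).2).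
Proof.
move=> [F rF HF]; exists (fun n => nsnd (F n)); first exact: rec1_comp rec1_nsnd rF.
by move=> x; rewrite HF; apply: npairK2.
Qed.

End Computable.

Section ComputableControl.
Context {C T U : Type}.
Context {eC : encoding C} {eT : encoding T} {eU : encoding U}.

Lemma computable_rec1 F (f : C -> nat) :
  rec1 F -> computable f -> computable (fun x => F (f x)).
Proof. by move=> rF; apply: computable_comp; exists F. Qed.

Lemma computable_rec2 F (f g : C -> nat) :
  rec2 F -> computable f -> computable g -> computable (fun x => F (f x) (g x)).
Proof.
move=> rF [f' rf Hf] [g' rg Hg]; exists (fun n => F (f' n) (g' n)).
  exact: recn_comp2.
by move=> x; rewrite Hf Hg.
Qed.

Lemma computable_nat_of_bool (f : C -> bool) :
  computable f -> computable (fun x => nat_of_bool (f x)).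
Proof. by move=> [F rF HF]; exists F. Qed.

Lemma computable_bool (f : C -> bool) :
  computable (fun x => nat_of_bool (f x)) -> computable f.
Proof. by move=> [F rF HF]; exists F. Qed.

(** On codes the case distinction is the arithmetic expression c f + (1 - c) g. Both branches are
    always evaluated, which is harmless for total functions. *)
Lemma computable_if (c : C -> bool) (f g : C -> T) :
  computable c -> computable f -> computable g ->
  computable (fun x => if c x then f x else g x).
Proof.
move=> [c' rc Hc] [f' rf Hf] [g' rg Hg].
exists (fun n => c' n * f' n + (1 - c' n) * g' n).
  apply: (recn_comp2 rec2_add); first exact: (recn_comp2 rec2_mul).
  apply: (recn_comp2 rec2_mul _ rg).
  exact: (recn_comp2 rec2_sub (recn_const _ 1) rc).
by move=> x; rewrite Hc Hf Hg; case: (c x); rewrite ?mul1n ?mul0n ?addn0.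
Qed.

Lemma computable_cons (f : C -> T) (g : C -> seq T) :
  computable f -> computable g -> computable (fun x => f x :: g x).
Proof.
move=> [F rF HF] [G rG HG]; exists (fun n => npair (F n) (G n)).
  exact: rec1_npair.
by move=> x; rewrite HF HG.
Qed.

Lemma computable_iteri (k : C -> nat) (g : C -> nat -> T -> T) (z : C -> T) :
  computable k -> computable (fun p : C * (nat * T) => g p.1 p.2.1 p.2.2) ->
  computable z ->
  computable (fun x => iteri (k x) (fun i s => g x i s) (z x)).
Proof.
move=> [K rK HK] [G rG HG] [Z rZ HZ].
exists (fun n => nat_rect (fun=> nat) (Z n) (fun i h => G (npair n (npair i h))) (K n)).
  exact: (rec1_rec rZ rG rK rec1_id).
move=> x; rewrite HK HZ /=.
change (enc (k x)) with (k x); by elim: (k x) => //= i ->; exact: (HG (x, (i, iteri i (fun i s => g x i s) (z x)))).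
Qed.

Lemma computable_foldl (l : C -> seq T) (g : C -> U -> T -> U) (z : C -> U) :
  computable l -> computable (fun p : C * (U * T) => g p.1 p.2.1 p.2.2) ->
  computable z ->
  computable (fun x => foldl (fun s y => g x s y) (z x) (l x)).
Proof.
move=> [L rL HL] [G rG HG] [Z rZ HZ].
(* The state is the pair of the remaining list and the accumulator, and the
   code of a list bounds its length. *)
pose stop s := 1 - nfst s.
pose next n s := npair (nsnd (nfst s)) (G (npair n (npair (nsnd s) (nfst (nfst s))))).
pose step p := let n := nfst p in let s := nsnd (nsnd p) in
  stop s * s + (1 - stop s) * next n s.
have rstep : rec1 step.
  have rs : rec1 (fun p => nsnd (nsnd p)) by exact: (rec1_comp rec1_nsnd rec1_nsnd).
  have rst : rec1 (fun p => stop (nsnd (nsnd p))).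
    apply: (recn_comp2 rec2_sub (recn_const _ 1)).
    exact: (rec1_comp rec1_nfst rs).
  have rff : rec1 (fun p => nfst (nsnd (nsnd p))) by exact: (rec1_comp rec1_nfst rs).
  have rnext : rec1 (fun p => next (nfst p) (nsnd (nsnd p))).
    apply: rec1_npair; first exact: (rec1_comp rec1_nsnd rff).
    apply: (rec1_comp rG); apply: rec1_npair; first exact: rec1_nfst.
    apply: rec1_npair; first exact: (rec1_comp rec1_nsnd rs).
    exact: (rec1_comp rec1_nfst rff).
  apply: (recn_comp2 rec2_add); first exact: (recn_comp2 rec2_mul rst rs).
  apply: (recn_comp2 rec2_mul _ rnext).
  exact: (recn_comp2 rec2_sub (recn_const _ 1) rst).
exists (fun n => nsnd (nat_rect (fun=> nat) (npair (L n) (Z n))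
                 (fun i h => step (npair n (npair i h))) (L n))).
  apply: (rec1_comp rec1_nsnd).
  exact: (rec1_rec (rec1_npair rL rZ) rstep rL rec1_id).
move=> x; rewrite HL HZ; have size_enc (s : seq T) : size s <= enc s.
  elim: s => //= y s IHs; apply: leq_trans (_ : (enc s).*2.+1 <= _).
    by rewrite ltnS (leq_trans IHs) // -addnn leq_addr.
  by rewrite leq_pmull ?expn_gt0.
pose step' s := stop s * s + (1 - stop s) * next (@enc C eC x) s.
have stepE m u : nat_rect (fun=> nat) u
    (fun i h => step (npair (enc x) (npair i h))) m = iter m step' u.
  by elim: m => //= m ->; rewrite /step !(npairK1, npairK2).
(* The number of steps may exceed the length of the list; the surplus steps leave the final state
   unchanged. *)
have iter_nil k u : iter k step' (npair 0 u) = npair 0 u.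
  by elim: k => //= k ->; rewrite /step' /stop npairK1 mul1n addn0.
have step_cons y s u : step' (npair (enc (y :: s)) (enc u)) =
    npair (enc s) (enc (g x u y)).
  rewrite /step' /stop npairK1; have -> : 1 - enc (y :: s) = 0.
    by apply/eqP; rewrite subn_eq0 /enc /= muln_gt0 expn_gt0.
  rewrite mul0n subn0 mul1n /next !(npairK1, npairK2).
  by rewrite (HG (x, (u, y))).
have main m s u : size s <= m ->
    nsnd (iter m step' (npair (enc s) (enc u))) = enc (foldl (fun s y => g x s y) u s).
  elim: m s u => [|m IHm] [|y s] u //.
  - by rewrite npairK2.
  - by rewrite iter_nil npairK2.
  - by move=> /IHm <-; rewrite iterSr step_cons.
by rewrite stepE main.
Qed.

End ComputableControl.

Section ComputableArithmetic.
Context {C : Type} {eC : encoding C}.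
Implicit Types (f g : C -> nat) (b c : C -> bool).

Lemma computable_succ f : computable f -> computable (fun x => (f x).+1).
Proof. exact: computable_rec1 rec1_succ. Qed.

Lemma computable_pred f : computable f -> computable (fun x => (f x).-1).
Proof. exact: computable_rec1 rec1_pred. Qed.

Lemma computable_half f : computable f -> computable (fun x => (f x)./2).
Proof. exact: computable_rec1 rec1_half. Qed.

Lemma computable_odd f : computable f -> computable (fun x => odd (f x)).
Proof.
move=> cf; apply: computable_bool.
exact: (computable_rec1 (F := fun n => odd n) rec1_odd).
Qed.

Lemma computable_add f g :
  computable f -> computable g -> computable (fun x => f x + g x).
Proof. exact: computable_rec2 rec2_add. Qed.

Lemma computable_double f : computable f -> computable (fun x => (f x).*2).
Proof.
move=> cf; apply: eq_computable (computable_add cf cf) => x; exact: addnn.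
Qed.

Lemma computable_sub f g :
  computable f -> computable g -> computable (fun x => f x - g x).
Proof. exact: computable_rec2 rec2_sub. Qed.

Lemma computable_mul f g :
  computable f -> computable g -> computable (fun x => f x * g x).
Proof. exact: computable_rec2 rec2_mul. Qed.

Lemma computable_leq f g :
  computable f -> computable g -> computable (fun x => f x <= g x).
Proof.
move=> cf cg; apply: computable_bool.
apply: eq_computable (computable_sub (computable_const 1) (computable_sub cf cg)).
by move=> x; rewrite -subn_eq0; case: (_ - g x).
Qed.

Lemma computable_negb b : computable b -> computable (fun x => ~~ b x).
Proof.
move=> cb.
apply: eq_computable (computable_if cb (computable_const false) (computable_const true)).
by move=> x; case: (b x).
Qed.

Lemma computable_andb b c :
  computable b -> computable c -> computable (fun x => b x && c x).
Proof. by move=> cb cc; apply: (computable_if cb cc (computable_const false)). Qed.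

Lemma computable_orb b c :
  computable b -> computable c -> computable (fun x => b x || c x).
Proof. by move=> cb cc; apply: (computable_if cb (computable_const true) cc). Qed.

Lemma computable_eqn f g :
  computable f -> computable g -> computable (fun x => f x == g x).
Proof.
move=> cf cg; apply: eq_computable
  (computable_andb (computable_leq cf cg) (computable_leq cg cf)) => x.
by rewrite eqn_leq.
Qed.

End ComputableArithmetic.

Section ComputableSeq.
Context {C T U : Type} {eC : encoding C} {eT : encoding T} {eU : encoding U}.

Lemma computable_iter (k : C -> nat) (g : C -> T -> T) (z : C -> T) :
  computable k -> computable (fun p : C * (nat * T) => g p.1 p.2.2) ->
  computable z ->
  computable (fun x => iter (k x) (fun s => g x s) (z x)).
Proof.
move=> ck cg cz.
apply: eq_computable (computable_iteri (g := fun x _ s => g x s) ck cg cz) => x.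
by elim: (k x) => //= m ->.
Qed.

Lemma computable_rev (l : C -> seq T) :
  computable l -> computable (fun x => rev (l x)).
Proof.
move=> cl; apply: eq_computable (computable_foldl (g := fun _ s y => y :: s) cl _
  (computable_const [::])) => [x|].
  rewrite /rev; elim: (l x) [::] => //= y s IHs t; exact: IHs.
apply: computable_cons; last exact/computable_fst/computable_snd/computable_id.
exact/computable_snd/computable_snd/computable_id.
Qed.

Lemma computable_foldr (l : C -> seq T) (g : C -> T -> U -> U) (z : C -> U) :
  computable l -> computable (fun p : C * (U * T) => g p.1 p.2.2 p.2.1) ->
  computable z ->
  computable (fun x => foldr (fun y s => g x y s) (z x) (l x)).
Proof.
move=> cl cg cz; apply: eq_computable
  (computable_foldl (g := fun x s y => g x y s) (computable_rev cl) cg cz) => x.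
by rewrite foldl_rev.
Qed.

End ComputableSeq.

Section ComputableSeqMap.
Context {C T U : Type} {eC : encoding C} {eT : encoding T} {eU : encoding U}.

Lemma computable_cat (f g : C -> seq T) :
  computable f -> computable g -> computable (fun x => f x ++ g x).
Proof.
move=> cf cg; apply: eq_computable
  (computable_foldr (g := fun _ y s => y :: s) cf _ cg) => [x|].
  by elim: (f x) => //= y s ->.
apply: computable_cons; last exact/computable_fst/computable_snd/computable_id.
exact/computable_snd/computable_snd/computable_id.
Qed.

Lemma computable_map (f : C -> T -> U) (l : C -> seq T) :
  computable (fun p : C * (seq U * T) => f p.1 p.2.2) -> computable l ->
  computable (fun x => [seq f x y | y <- l x]).
Proof.
move=> cf cl; apply: eq_computable
  (computable_foldr (g := fun x y s => f x y :: s) cl _ (computable_const [::])) => [x|].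
  by elim: (l x) => //= y s ->.
by apply: (computable_cons cf); exact/computable_fst/computable_snd/computable_id.
Qed.

Lemma computable_filter (b : C -> T -> bool) (l : C -> seq T) :
  computable (fun p : C * (seq T * T) => b p.1 p.2.2) -> computable l ->
  computable (fun x => [seq y <- l x | b x y]).
Proof.
move=> cb cl; apply: eq_computable
  (computable_foldr (g := fun x y s => if b x y then y :: s else s) cl _
    (computable_const [::])) => [x|].
  by elim: (l x) => //= y s ->.
have cs : computable (fun p : C * (seq T * T) => p.2.1).
  exact/computable_fst/computable_snd/computable_id.
apply: (computable_if cb _ cs); apply: computable_cons cs.
exact/computable_snd/computable_snd/computable_id.
Qed.

Lemma computable_size (l : C -> seq T) :
  computable l -> computable (fun x => size (l x)).
Proof.
move=> cl; apply: eq_computable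
  (computable_foldr (g := fun _ _ s => s.+1) cl _ (computable_const 0)) => [x|].
  by elim: (l x) => //= y s ->.
exact/computable_succ/computable_fst/computable_snd/computable_id.
Qed.

End ComputableSeqMap.

Section ComputableSeqFlatten.
Context {C T : Type} {eC : encoding C} {eT : encoding T}.

Lemma computable_flatten (l : C -> seq (seq T)) :
  computable l -> computable (fun x => flatten (l x)).
Proof.
move=> cl; apply: (computable_foldr (g := fun _ => cat) cl _ (computable_const [::])).
apply: computable_cat; last exact/computable_fst/computable_snd/computable_id.
exact/computable_snd/computable_snd/computable_id.
Qed.

Lemma computable_nseq (k : C -> nat) (f : C -> T) :
  computable k -> computable f -> computable (fun x => nseq (k x) (f x)).
Proof.
move=> ck cf; apply: eq_computable
  (computable_iter (g := fun x s => f x :: s) ck _ (computable_const [::])) => [x|].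
  by elim: (k x) => //= m ->.
apply: computable_cons; last exact/computable_snd/computable_snd/computable_id.
exact: (computable_comp cf (computable_fst computable_id)).
Qed.

Lemma computable_iota (f g : C -> nat) :
  computable f -> computable g -> computable (fun x => iota (f x) (g x)).
Proof.
move=> cf cg; apply: eq_computable (computable_iteri
  (g := fun x i s => rcons s (f x + i)) cg _ (computable_const [::])) => [x|].
  by elim: (g x) => // m IHm; rewrite -[in RHS]addn1 iotaD /= IHm cats1.
have cs : computable (fun p : C * (nat * seq nat) => p.2.2).
  exact/computable_snd/computable_snd/computable_id.
under eq_fun do rewrite -cats1.
apply: (computable_cat cs); apply: computable_cons (computable_const [::]).
apply: computable_add; first exact: (computable_comp cf (computable_fst computable_id)).
exact/computable_fst/computable_snd/computable_id.
Qed.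

(** A fixed finite table becomes a nested case distinction. In this way unknown finite data of the
    group are built into an algorithm. *)
Lemma computable_nth_const (d : T) (tbl : seq T) (f : C -> nat) :
  computable f -> computable (fun x => nth d tbl (f x)).
Proof.
elim: tbl f => [|y tbl IHtbl] f cf.
  by apply: eq_computable (computable_const d) => x; rewrite nth_nil.
apply: eq_computable (computable_if (computable_eqn cf (computable_const 0))
  (computable_const y) (IHtbl _ (computable_pred cf))) => x.
by case: (f x).
Qed.

End ComputableSeqFlatten.

Section ComputableDivision.
Context {C : Type} {eC : encoding C}.
Implicit Types (f g : C -> nat).

Lemma computable_divn f g :
  computable f -> computable g -> computable (fun x => f x %/ g x).
(* The quotient is the number of [i < f x] with (i + 1) g(x) <= f(x); division by 0 gives 0. *)
Proof.
move=> cf cg; have c : computable (fun x => if g x == 0 then 0 else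
    size [seq i <- iota 0 (f x) | i.+1 * g x <= f x]).
  refine (computable_if (computable_eqn cg (computable_const 0)) (computable_const 0)
    (computable_size (computable_filter _ (computable_iota (computable_const 0) cf)))).
  have c1 : computable (fun p : C * (seq nat * nat) => p.1).
    exact/computable_fst/computable_id.
  have c2 : computable (fun p : C * (seq nat * nat) => p.2.2).
    exact/computable_snd/computable_snd/computable_id.
  exact: (computable_leq (computable_mul (computable_succ c2) (computable_comp cg c1))
    (computable_comp cf c1)).
apply: eq_computable c => x; case: eqP => [->|/eqP]; rewrite ?divn0 // -lt0n => g0.
have leq_div : f x %/ g x <= f x by apply: leq_div.
rewrite -[X in iota 0 X](subnKC leq_div) iotaD filter_cat size_cat.
rewrite (@eq_in_filter _ _ predT) => [|i]; last first.
  by rewrite mem_iota -leq_divRL.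
rewrite filter_predT size_iota (@eq_in_filter _ _ pred0) => [|i]; last first.
  by rewrite mem_iota -leq_divRL // => /andP[le_i _]; rewrite ltnNge le_i.
by rewrite filter_pred0 addn0.
Qed.

Lemma computable_dvdn f g :
  computable f -> computable g -> computable (fun x => f x %| g x).
Proof.
move=> cf cg.
have c := computable_eqn (computable_mul (computable_divn cg cf) cf) cg.
by apply: eq_computable c => x; rewrite dvdn_eq.
Qed.

Lemma computable_expn f g :
  computable f -> computable g -> computable (fun x => f x ^ g x).
Proof.
move=> cf cg; have c : computable (fun x => iter (g x) (fun s => f x * s) 1).
  apply: (computable_iter (g := fun x s => f x * s) cg _ (computable_const 1)).
  apply: computable_mul; first exact: (computable_comp cf (computable_fst computable_id)).
  exact/computable_snd/computable_snd/computable_id.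
by apply: eq_computable c => x; elim: (g x) => //= m ->; rewrite expnS.
Qed.

End ComputableDivision.

(** Recursion on the head symbol of the body, with computability facts from the context for the
    remaining functions. The last case first checks that the body is an [if], so that unification
    does not unfold other terms into one. *)
Ltac computable :=
  lazymatch goal with
  | H : @computable _ _ _ _ ?f |- @computable _ _ _ _ ?f => exact: H
  | |- @computable _ _ _ _ (fun x => x) => exact: computable_id
  | |- @computable _ _ _ _ (fun x => fst (@?f x)) =>
      apply: (@computable_fst _ _ _ _ _ _ f); computable
  | |- @computable _ _ _ _ (fun x => snd (@?f x)) =>
      apply: (@computable_snd _ _ _ _ _ _ f); computable
  | |- @computable _ _ _ _ (fun _ => ?c) => exact: computable_const
  | |- @computable _ _ _ _ (fun x => (@?f x, @?g x)) =>
      refine (@computable_pair _ _ _ _ _ _ f g _ _); computable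
  | |- @computable _ _ _ _ (fun x => @?f x :: @?g x) =>
      refine (@computable_cons _ _ _ _ f g _ _); computable
  | |- @computable _ _ _ _ (fun x => S (@?f x)) =>
      refine (@computable_succ _ _ f _); computable
  | |- @computable _ _ _ _ (fun x => predn (@?f x)) =>
      refine (@computable_pred _ _ f _); computable
  | |- @computable _ _ _ _ (fun x => half (@?f x)) =>
      refine (@computable_half _ _ f _); computable
  | |- @computable _ _ _ _ (fun x => odd (@?f x)) =>
      refine (@computable_odd _ _ f _); computable
  | |- @computable _ _ _ _ (fun x => double (@?f x)) =>
      refine (@computable_double _ _ f _); computable
  | |- @computable _ _ _ _ (fun x => nat_of_bool (@?f x)) =>
      refine (@computable_nat_of_bool _ _ f _); computable
  | |- @computable _ _ _ _ (fun x => addn (@?f x) (@?g x)) =>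
      refine (@computable_add _ _ f g _ _); computable
  | |- @computable _ _ _ _ (fun x => subn (@?f x) (@?g x)) =>
      refine (@computable_sub _ _ f g _ _); computable
  | |- @computable _ _ _ _ (fun x => muln (@?f x) (@?g x)) =>
      refine (@computable_mul _ _ f g _ _); computable
  | |- @computable _ _ _ _ (fun x => divn (@?f x) (@?g x)) =>
      refine (@computable_divn _ _ f g _ _); computable
  | |- @computable _ _ _ _ (fun x => dvdn (@?f x) (@?g x)) =>
      refine (@computable_dvdn _ _ f g _ _); computable
  | |- @computable _ _ _ _ (fun x => expn (@?f x) (@?g x)) =>
      refine (@computable_expn _ _ f g _ _); computable
  | |- @computable _ _ _ _ (fun x => leq (@?f x) (@?g x)) =>
      refine (@computable_leq _ _ f g _ _); computable
  | |- @computable _ _ _ _ (fun x => @eq_op _ (@?f x) (@?g x)) =>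
      refine (@computable_eqn _ _ f g _ _); computable
  | |- @computable _ _ _ _ (fun x => negb (@?f x)) =>
      refine (@computable_negb _ _ f _); computable
  | |- @computable _ _ _ _ (fun x => andb (@?f x) (@?g x)) =>
      refine (@computable_andb _ _ f g _ _); computable
  | |- @computable _ _ _ _ (fun x => orb (@?f x) (@?g x)) =>
      refine (@computable_orb _ _ f g _ _); computable
  | |- @computable _ _ _ _ (fun x => rev (@?f x)) =>
      refine (@computable_rev _ _ _ _ f _); computable
  | |- @computable _ _ _ _ (fun x => size (@?f x)) =>
      refine (@computable_size _ _ _ _ f _); computable
  | |- @computable _ _ _ _ (fun x => flatten (@?f x)) =>
      refine (@computable_flatten _ _ _ _ f _); computable
  | |- @computable _ _ _ _ (fun x => @?f x ++ @?g x) =>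
      refine (@computable_cat _ _ _ _ f g _ _); computable
  | |- @computable _ _ _ _ (fun x => nseq (@?f x) (@?g x)) =>
      refine (@computable_nseq _ _ _ _ f g _ _); computable
  | |- @computable _ _ _ _ (fun x => iota (@?f x) (@?g x)) =>
      refine (@computable_iota _ _ f g _ _); computable
  | |- @computable _ _ _ _ (fun x => nth _ _ (@?f x)) =>
      refine (@computable_nth_const _ _ _ _ _ _ f _); computable
  | |- @computable _ _ _ _ (fun x => map (fun y => @?f x y) (@?l x)) =>
      refine (@computable_map _ _ _ _ _ _ f l _ _); computable
  | |- @computable _ _ _ _ (fun x => filter (fun y => @?f x y) (@?l x)) =>
      refine (@computable_filter _ _ _ _ f l _ _); computable
  | |- @computable _ _ _ _ (fun x => foldl (fun s y => @?f x s y) (@?z x) (@?l x)) =>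
      refine (@computable_foldl _ _ _ _ _ _ l f z _ _ _); computable
  | |- @computable _ _ _ _ (fun x => foldr (fun y s => @?f x y s) (@?z x) (@?l x)) =>
      refine (@computable_foldr _ _ _ _ _ _ l f z _ _ _); computable
  | |- @computable _ _ _ _ (fun x => iter (@?k x) (fun s => @?f x s) (@?z x)) =>
      refine (@computable_iter _ _ _ _ k f z _ _ _); computable
  | H : @computable _ _ _ _ ?f |- @computable _ _ _ _ (fun x => ?f (@?g x)) =>
      refine (@computable_comp _ _ _ _ _ _ f g H _); computable
  | |- @computable ?T _ _ _ ?F =>
      let is_if := constr:(fun z : T => ltac:(
        let b := eval cbv beta in (F z) in
        lazymatch b with if _ then _ else _ => exact tt end)) in
      refine (@computable_if _ _ _ _ _ _ _ _ _ _); computable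
  end.

(** * Words and decidable families *)

Section Words.
Local Open Scope group_scope.
Variable G : groupType.
Implicit Types (x y : nat -> G) (s u : seq nat) (g h t : G).

(* The letters x_k and x_k^-1 are numbered 2k and 2k+1, as in [letter_code]. *)
Definition leval x (l : nat) : G := if odd l then (x l./2)^-1 else x l./2.

Definition weval x s : G := \prod_(l <- s) leval x l.

Definition linv (l : nat) : nat := if odd l then l.-1 else l.+1.

Definition winv s : seq nat := rev [seq linv l | l <- s].

Definition wsubst (phi : nat -> seq nat) s : seq nat :=
  flatten [seq if odd l then winv (phi l./2) else phi l./2 | l <- s].

Definition inspan x g := exists s, g = weval x s.

(** The word problem of the subgroup generated by a family, relative to that family. It may be
    infinite, as is needed for the monomials of a module. *)
Definition wp x := computable (fun s => weval x s == 1).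

Lemma weval_nil x : weval x [::] = 1.
Proof. exact: big_nil. Qed.

Lemma weval_cons x l s : weval x (l :: s) = leval x l * weval x s.
Proof. exact: big_cons. Qed.

Lemma weval_cat x s u : weval x (s ++ u) = weval x s * weval x u.
Proof. exact: big_cat. Qed.

Lemma weval1 x l : weval x [:: l] = leval x l.
Proof. by rewrite weval_cons weval_nil mulg1. Qed.

Lemma leval_double x k : leval x k.*2 = x k.
Proof. by rewrite /leval odd_double doubleK. Qed.

Lemma leval_doubleS x k : leval x k.*2.+1 = (x k)^-1.
Proof. by rewrite /leval /= odd_double uphalf_double. Qed.

Lemma leval_linv x l : leval x (linv l) = (leval x l)^-1.
Proof.
rewrite -[l]odd_double_half; case: (odd l); rewrite /linv /= odd_double /=.
  by rewrite add1n leval_double leval_doubleS invgK.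
by rewrite leval_double leval_doubleS.
Qed.

Lemma weval_winv x s : weval x (winv s) = (weval x s)^-1.
Proof.
rewrite /winv; elim: s => [|l s IHs]; first by rewrite !weval_nil invg1.
by rewrite /= rev_cons -cats1 weval_cat IHs weval1 leval_linv weval_cons invgM.
Qed.

Lemma weval_nseq x k s : weval x (flatten (nseq k s)) = weval x s ^+ k.
Proof.
by elim: k => [|k IHk] /=; rewrite ?weval_nil // weval_cat IHk expgS.
Qed.

Lemma weval_subst x y phi s :
  (forall k, y k = weval x (phi k)) -> weval x (wsubst phi s) = weval y s.
Proof.
move=> yE; rewrite /wsubst; elim: s => [|l s IHs]; first by rewrite !weval_nil.
rewrite /= weval_cat IHs weval_cons /leval.
by case: (odd l); rewrite ?weval_winv yE.
Qed.

Lemma weval_conj x s g : weval (fun k => x k ^ g) s = weval x s ^ g.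
Proof.
elim: s => [|l s IHs]; first by rewrite !weval_nil conj1g.
by rewrite !weval_cons IHs conjMg /leval; case: ifP; rewrite ?conjVg.
Qed.

Lemma inspan1 x : inspan x 1.
Proof. by exists [::]; rewrite weval_nil. Qed.

Lemma inspanM x g h : inspan x g -> inspan x h -> inspan x (g * h).
Proof. by move=> [s ->] [u ->]; exists (s ++ u); rewrite weval_cat. Qed.

Lemma inspanV x g : inspan x g -> inspan x g^-1.
Proof. by move=> [s ->]; exists (winv s); rewrite weval_winv. Qed.

Lemma inspan_gen x k : inspan x (x k).
Proof. by exists [:: k.*2]; rewrite weval1 leval_double. Qed.

Lemma inspan_sub x y g :
  (forall k, inspan y (x k)) -> inspan x g -> inspan y g.
Proof.
by move=> /choice[phi Hphi] [s ->]; exists (wsubst phi s); rewrite -(weval_subst s Hphi).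
Qed.

Lemma computable_winv : computable winv.
Proof. by rewrite /winv /linv; computable. Qed.

Lemma computable_wsubst phi : computable phi -> computable (wsubst phi).
Proof.
by move=> cphi; have cinv := computable_winv; rewrite /wsubst; computable.
Qed.

Lemma wp_subst x y phi :
  computable phi -> (forall k, y k = weval x (phi k)) -> wp x -> wp y.
Proof.
move=> /computable_wsubst cphi yE wpx.
have c : computable (fun s => weval x (wsubst phi s) == 1).
  exact: (computable_comp wpx cphi).
by apply: eq_computable c => s; rewrite (weval_subst s yE).
Qed.

(** Integer exponents are represented by two naturals with truncated subtraction. One of the two
    remaining factors is trivial, so that membership in a subgroup can be tested on each factor
    separately. *)
Lemma expg_cancel t p q :
  t ^+ p * t ^- q = t ^+ (p - q) * t ^- (q - p) /\
  (t ^+ (p - q) = 1 \/ t ^+ (q - p) = 1).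
Proof.
case: (leqP q p) => [le|/ltnW le]; move: (le); rewrite -subn_eq0 => /eqP->.
  by rewrite !expg0 invg1 mulg1 expgnFr //; split=> //; right.
by rewrite !expg0 mul1g expgnFr // invgM invgK; split=> //; left.
Qed.

(* Covers both cyclic quotients: m is the order of the image of g, 0 if it is
   infinite. *)
Lemma expg_mod_subgroup (H : set G) g :
  is_subgroup H -> exists m, forall e, H (g ^+ e) <-> m %| e.
Proof.
move=> [H1 HM HV].
have Hsub a b : b <= a -> H (g ^+ a) -> H (g ^+ b) -> H (g ^+ (a - b)).
  by move=> ba Ha Hb; rewrite expgnFr //; apply: HM => //; apply: HV.
have Hmul a b : H (g ^+ a) -> H (g ^+ (a * b)).
  move=> Ha; elim: b => [|b IHb]; first by rewrite muln0 expg0.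
  by rewrite mulnS expgnDr; apply: HM.
have [[m [m0 Hm]]|noH] := pselect (exists m, 0 < m /\ H (g ^+ m)); last first.
  exists 0 => e; rewrite dvd0n; split=> [He|/eqP->]; last by rewrite expg0.
  by case: (posnP e) => // e0; case: noH; exists e.
have exP : exists m, (0 < m) && `[< H (g ^+ m) >].
  by exists m; rewrite m0; apply/asboolP.
case: (ex_minnP exP) => {m m0 Hm} m /andP[m0 /asboolP Hm] min_m; exists m => e.
split=> [He|/dvdnP[q ->]]; last by rewrite mulnC; apply: Hmul.
rewrite /dvdn; apply: contraT; rewrite -lt0n => r0.
have: m <= e %% m.
  apply: min_m; rewrite r0 /=; apply/asboolP.
  have -> : (e %% m = e - m * (e %/ m))%N.
    by rewrite {2}(divn_eq e m) mulnC addKn.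
  by apply: Hsub => //; [rewrite mulnC leq_trunc_div | apply: Hmul].
by rewrite leqNgt ltn_mod m0.
Qed.

Lemma inspan_subgroup x : is_subgroup (inspan x).
Proof. split; [exact: inspan1 | exact: inspanM | exact: inspanV]. Qed.

(** The new generator has index 0, hence the letters 0 and 1; all letters of [x] move up by 2. *)
Definition fcons t x (k : nat) : G := if k is k'.+1 then x k' else t.

Lemma leval_fcons t x l : leval (fcons t x) l.+2 = leval x l.
Proof. by rewrite /leval /= negbK. Qed.

Definition wshift s : seq nat := [seq l.+2 | l <- s].

Lemma weval_shift t x s : weval (fcons t x) (wshift s) = weval x s.
Proof.
elim: s => [|l s IHs]; first by rewrite !weval_nil.
by rewrite /= !weval_cons leval_fcons IHs.
Qed.

(* An element of <t, x> is written u t^p t^-q with u in <x>. *)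
Lemma wp_fcons t x phi psi :
  wp x -> computable phi -> computable psi ->
  (forall k, x k ^ t^-1 = weval x (phi k)) ->
  (forall k, x k ^ t = weval x (psi k)) -> wp (fcons t x).
Proof.
move=> wpx /computable_wsubst cphi /computable_wsubst cpsi phiE psiE.
have [m Hm] := expg_mod_subgroup t (inspan_subgroup x).
(* The number [m] and the word [z] for t^m are fixed finite data; no procedure has to find them. *)
have [z Hz] : inspan x (t ^+ m) by apply/Hm.
(* Words are read from the right. A new letter t is moved across u by t u = (t u t^-1) t, which
   replaces u by its image under [phi]; for t^-1 the words [psi] are used. *)
pose step (l : nat) (r : seq nat * (nat * nat)) :=
  if l == 0 then (wsubst phi r.1, (r.2.1.+1, r.2.2)) else
  if l == 1%N then (wsubst psi r.1, (r.2.1, r.2.2.+1)) else (l.-2 :: r.1, r.2).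
pose norm s := foldr step ([::], (0, 0)) s.
have cnorm : computable norm by rewrite /norm /step; computable.
have normE s : weval (fcons t x) s =
    weval x (norm s).1 * t ^+ (norm s).2.1 * t ^- (norm s).2.2.
  elim: s => [|l s IHs]; first by rewrite !weval_nil !expg0 invg1 !mulg1.
  rewrite weval_cons IHs /norm /= -/(norm s); case: (norm s) => u [p q] /=.
  case: l => [|[|l]] /=.
  - rewrite (weval_subst u phiE) weval_conj conjgE invgK /leval /= expgS.
    by rewrite !mulgA mulgVK.
  - rewrite (weval_subst u psiE) weval_conj conjgE /leval /= expgSr invgM.
    have tp : t * t ^+ p = t ^+ p * t by rewrite -expgS expgSr.
    rewrite !mulgA -(mulgA _ t (t ^+ p)) tp !mulgA.
    by congr (_ * _); rewrite mulgK.
  - by rewrite leval_fcons weval_cons !mulgA.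
(* A trivial word has its power of t in the span of [x], so its exponent is a multiple of [m]. That
   power can then be replaced by a power of [z], and the rest is decided in [x]. *)
pose dec (s : seq nat) := let r := norm s in let p := r.2.1 in let q := r.2.2 in
  [&& m %| p - q, m %| q - p & weval x (r.1 ++
     flatten (nseq ((p - q) %/ m) z) ++ flatten (nseq ((q - p) %/ m) (winv z))) == 1].
have cdec : computable dec.
  have c1 : computable (fun s => (norm s).2.1 - (norm s).2.2) by computable.
  have c2 : computable (fun s => (norm s).2.2 - (norm s).2.1) by computable.
  have d1 := computable_dvdn (computable_const m) c1.
  have d2 := computable_dvdn (computable_const m) c2.
  have e1 := computable_divn c1 (computable_const m).
  have e2 := computable_divn c2 (computable_const m).
  have cn1 : computable (fun s => (norm s).1) by computable.
  have c : computable (fun s => weval x ((norm s).1 ++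
     flatten (nseq (((norm s).2.1 - (norm s).2.2) %/ m) z) ++
     flatten (nseq (((norm s).2.2 - (norm s).2.1) %/ m) (winv z))) == 1).
    by apply: (computable_comp wpx); computable.
  by apply: computable_andb => //; apply: computable_andb.
apply: eq_computable cdec => s; rewrite normE /dec.
case: (norm s) => u [p q] /=; rewrite !weval_cat !weval_nseq weval_winv.
have [tpq t1] := expg_cancel t p q.
have tE a : m %| a -> weval x z ^+ (a %/ m) = t ^+ a.
  by move=> ma; rewrite -Hz -expgnA mulnC divnK.
rewrite -mulgA tpq; apply/and3P/eqP => [[mpq mqp /eqP]|w1].
  by rewrite expVgn !tE.
have span_t : inspan x (t ^+ (p - q) * t ^- (q - p)).
  by rewrite -(mulg1_eq w1); apply: inspanV; exists u.
have [mpq mqp] : m %| p - q /\ m %| q - p.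
  case: t1 span_t => t1; rewrite t1 ?invg1 ?mul1g ?mulg1 => span_t; split; apply/Hm.
  - by rewrite t1; apply: inspan1.
  - by rewrite -[t ^+ _]invgK; apply: inspanV.
  - by [].
  - by rewrite t1; apply: inspan1.
by split=> //; rewrite expVgn !tE // w1.
Qed.

End Words.

(** * Extending decidable families by finitely many elements *)

Section Extension.
Local Open Scope group_scope.
Variable G : groupType.
Implicit Types (x y : nat -> G) (s u : seq nat) (g h t : G) (ts : seq G).

(** The head of the list is the element adjoined last. *)
Definition fcat ts x : nat -> G := foldr (@fcons G) x ts.

(** The words for the conjugates have to be computed uniformly in [k]. Conjugation by the inverse of
    [g] is a separate demand. *)
Definition normalises g x :=
  exists2 phi : nat -> seq nat, computable phi & forall k, x k ^ g = weval x (phi k).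

Lemma inspan_fcons t x g : inspan x g -> inspan (fcons t x) g.
Proof. by apply: inspan_sub => k; apply: (inspan_gen (fcons t x) k.+1). Qed.

Lemma inspan_fcat ts x g : inspan x g -> inspan (fcat ts x) g.
Proof. by move=> xg; elim: ts => //= t ts; apply: inspan_fcons. Qed.

Lemma inspan_fcat_mem ts x g : g \in ts -> inspan (fcat ts x) g.
Proof.
elim: ts => //= t ts IHts; rewrite inE => /predU1P[->|/IHts].
  exact: (inspan_gen (fcons t _) 0).
exact: inspan_fcons.
Qed.

Lemma inspan_conj x y g h :
  (forall k, inspan y (x k ^ g)) -> inspan x h -> inspan y (h ^ g).
Proof.
move=> xy [s ->]; rewrite -weval_conj.
by apply: (inspan_sub xy); exists s.
Qed.

(** One fixed word for the conjugate of [t] is all that has to be added to the algorithm for [x]. *)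
Lemma normalises_fcons g t x :
  normalises g x -> inspan (fcons t x) (t ^ g) -> normalises g (fcons t x).
Proof.
move=> [phi cphi phiE] [w wE].
exists (fun k => if k == 0 then w else wshift (phi k.-1)).
  by rewrite /wshift; computable.
by case=> [|k] /=; rewrite ?wE // weval_shift phiE.
Qed.

Fixpoint normal_chain (S : set G) ts x : Prop :=
  if ts is t :: us then
    (forall g, S g -> inspan (fcat ts x) (t ^ g)) /\ normal_chain S us x
  else True.

(** The induction also carries along that [S] normalises the family built so far: the next
    application of [wp_fcons] needs this for t and its inverse. *)
Lemma wp_fcat (S : set G) ts x :
  wp x -> (forall g, S g -> normalises g x) ->
  (forall t, t \in ts -> S t /\ S t^-1) -> normal_chain S ts x -> wp (fcat ts x).
Proof.
move=> wpx Sx tsS ch.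
suff: wp (fcat ts x) /\ forall g, S g -> normalises g (fcat ts x) by case.
elim: ts tsS ch => //= t ts IHts tsS [St chts].
have [|wpts Sts] := IHts _ chts.
  by move=> u uts; apply: tsS; rewrite inE uts orbT.
have [/Sts[psi cpsi psiE] /Sts[phi cphi phiE]] := tsS t (mem_head _ _).
split; first exact: wp_fcons wpts cphi cpsi phiE psiE.
by move=> g Sg; apply: normalises_fcons (Sts _ Sg) (St _ Sg).
Qed.

(** Each member of [L] is rewritten as a word in [y], and these words form a finite table; indices
    beyond [L] give the default 1, the value of the empty word. *)
Lemma wp_nth y (L : seq G) :
  (forall g, g \in L -> inspan y g) -> wp y -> wp (nth 1 L).
Proof.
move=> Ly; have [tbl tblE] : exists tbl, forall k, nth 1 L k = weval y (nth [::] tbl k).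
  elim: L Ly => [|g L IHL] Ly; first by exists [::] => k; rewrite !nth_nil weval_nil.
  have [w wE] := Ly g (mem_head _ _).
  have [|tbl tblE] := IHL; first by move=> h hL; apply: Ly; rewrite inE hL orbT.
  by exists (w :: tbl) => -[].
apply: wp_subst tblE.
exact: (computable_nth_const _ _ computable_id).
Qed.

Lemma inspan_conj_span x y g h :
  (forall k h', inspan y h' -> inspan y (h' ^ x k) /\ inspan y (h' ^ (x k)^-1)) ->
  inspan x g -> inspan y h -> inspan y (h ^ g).
Proof.
move=> xy [s ->]; elim: s h => [|l s IHs] h yh; first by rewrite weval_nil conjg1.
rewrite weval_cons conjgM; apply: IHs; rewrite /leval.
by case: (xy l./2 h yh); case: (odd l).
Qed.

End Extension.

(** * Nilpotent groups *)

Section Nilpotent.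
Local Open Scope group_scope.
Variables (G : groupType) (L : seq G).
Implicit Types (g h s t c : G) (ts : seq G).

Let one : nat -> G := fun=> 1.

Lemma wp_one : wp one.
Proof.
apply: eq_computable (computable_const true) => s; symmetry; apply/eqP.
rewrite /weval big1 // => l _; rewrite /leval /one.
by case: odd; rewrite ?invg1.
Qed.

(** Every entry commutes with the generators [L] modulo the span of the entries after it, as in a
    central series with cyclic factors. *)
Fixpoint central_chain ts : Prop :=
  if ts is t :: us then
    (forall s, s \in L -> inspan (fcat us one) (comm s t)) /\ central_chain us
  else True.

Lemma comm_mul s t : comm s t * t = t ^ s^-1.
Proof. by rewrite /comm mulgVK conjgE invgK mulgA. Qed.

Lemma central_chain_normal ts s h :
  central_chain ts -> s \in L -> inspan (fcat ts one) h ->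
  inspan (fcat ts one) (h ^ s) /\ inspan (fcat ts one) (h ^ s^-1).
Proof.
move=> + sL; elim: ts h => [|t ts IHts] h /= => [_|[tL chts]] hts.
  have triv k g : inspan one (one k ^ g) by rewrite conj1g; apply: inspan1.
  by split; apply: inspan_conj hts.
have {}IHts h' (h'ts : inspan (fcat ts one) h') := IHts h' chts h'ts.
have span_t : inspan (fcons t (fcat ts one)) t := inspan_gen (fcons t _) 0.
split; apply: inspan_conj hts => -[|k] /=.
(* The chain bounds [s, t], which gives conjugation by s^-1 directly. Conjugation by s needs in
   addition that the smaller span is stable, which is the induction hypothesis. *)
- have -> : t ^ s = (comm s t)^-1 ^ s * t.
    by rewrite /comm !invgM !invgK !conjgE !mulgA mulgVK !mulgVK.
  apply: inspanM => //; apply: inspan_fcons.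
  by have [] := IHts _ (inspanV (tL s sL)).
- by apply: inspan_fcons; have [] := IHts _ (inspan_gen _ k).
- by rewrite -comm_mul; apply: inspanM => //; apply/inspan_fcons/tL.
- by apply: inspan_fcons; have [] := IHts _ (inspan_gen _ k).
Qed.

Lemma central_chain_normal_chain ts :
  central_chain ts -> normal_chain (inspan (fcat L one)) ts one.
Proof.
elim: ts => //= t ts IHts [tL chts]; split; last exact: IHts.
move=> g gL; apply: (inspan_conj_span _ gL); last exact: (inspan_gen (fcons t _) 0).
have Lone k : fcat L one k = 1 \/ fcat L one k \in L.
  elim: L k => [|s L' IHL] k; first by left.
  case: k => [|k] /=; first by right; rewrite mem_head.
  by have [->|kL] := IHL k; [left | right; rewrite inE kL orbT].
move=> k h hts; have [->|kL] := Lone k; first by rewrite invg1 conjg1.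
exact: (@central_chain_normal (t :: ts)).
Qed.

(** The right-normed commutators of weight [w + 1] in the generators: index 0 stands for [L]
    itself. *)
Definition weight_comms (w : nat) : seq G :=
  iter w (fun C => [seq comm s c | s <- L, c <- C]) L.

(** Higher weights come later in the list, hence are adjoined earlier. *)
Fixpoint comms_chain (w n : nat) : seq G :=
  if n is n'.+1 then weight_comms w ++ comms_chain w.+1 n' else [::].

Lemma central_chain_cat us ts :
  (forall s t, s \in L -> t \in us -> inspan (fcat ts one) (comm s t)) ->
  central_chain ts -> central_chain (us ++ ts).
Proof.
move=> usL chts; elim: us usL => //= u us IHus usL; split.
  move=> s sL; rewrite /fcat foldr_cat; apply: inspan_fcat.
  by apply: usL => //; apply: mem_head.
by apply: IHus => s t sL tus; apply: usL; rewrite // inE tus orbT.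
Qed.

(** A commutator of a generator with an entry has the next weight: it is listed in the following
    block or, after the last block, is trivial by assumption. *)
Lemma central_comms_chain w n :
  (forall c, c \in weight_comms (w + n) -> c = 1) ->
  central_chain (comms_chain w n).
Proof.
elim: n w => //= n IHn w Hc; apply: central_chain_cat; last first.
  by apply: IHn; rewrite addSnnS.
move=> s t sL tw; have st : comm s t \in weight_comms w.+1.
  by apply/allpairsP; exists (s, t).
case: n {IHn} Hc => [|n] Hc.
  by rewrite (Hc (comm s t)) ?addn1 //; apply: inspan1.
by apply: inspan_fcat_mem; rewrite mem_cat st.
Qed.

Lemma word_eval_cat X (x : X -> G) (u v : word X) :
  word_eval x (u ++ v) = word_eval x u * word_eval x v.
Proof. exact: big_cat. Qed.

Lemma word_eval_inv X (x : X -> G) (u : word X) :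
  word_eval x (word_inv u) = (word_eval x u)^-1.
Proof.
rewrite /word_eval /word_inv; elim: u => [|l u IHu]; first by rewrite !big_nil invg1.
rewrite /= rev_cons -cats1 big_cat IHu big_seq1 big_cons invgM; congr (_ * _).
by rewrite /letter_eval; case: l => i [] /=; rewrite ?invgK.
Qed.

Lemma word_eval_comm X (x : X -> G) (u v : word X) :
  word_eval x (word_comm u v) = comm (word_eval x u) (word_eval x v).
Proof. by rewrite /word_comm !word_eval_cat !word_eval_inv !mulgA. Qed.

Lemma word_eval1 X (x : X -> G) (i : X) : word_eval x [:: (i, false)] = x i.
Proof. exact: big_seq1. Qed.

Lemma eq_nil_word (a b : nat -> G) k :
  (forall i, i <= k.+1 -> a i = b i) ->
  word_eval a (nil_word k) = word_eval b (nil_word k).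
Proof.
elim: k => [|k IHk] ab; first by rewrite !word_eval1 ab.
rewrite /= !word_eval_comm !word_eval1 ab // IHk // => i ik.
by apply: ab; apply: leqW.
Qed.

(** The outer letter of [nil_word k.+1] has number k + 2 and does not occur in [nil_word k], so the
    assignment can be changed there freely. *)
Lemma weight_comms_nil_word k c :
  c \in weight_comms k -> exists a, c = word_eval a (nil_word k).
Proof.
elim: k c => [|k IHk] c; first by exists (fun=> c); rewrite word_eval1.
move=> /allpairsP[[s d] /= [sL /IHk[a ->] ->]].
exists (fun i => if i == k.+2 then s else a i).
rewrite word_eval_comm word_eval1 eqxx; congr comm.
by apply: eq_nil_word => i; case: eqP => // ->; rewrite ltnn.
Qed.

(** The commutators of weights 1 to k form a central chain over the trivial family, since those of
    weight k + 1 vanish. As k > 0, the chain contains [L]. *)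
Lemma wp_nilpotent k :
  0 < k -> (forall a : nat -> G, word_eval a (nil_word k) = 1) -> wp (nth 1 L).
Proof.
move=> k0 law; pose ts := comms_chain 0 k.
have chts : central_chain ts.
  apply: central_comms_chain => c /weight_comms_nil_word[a ->]; exact: law.
have weightL w c : c \in weight_comms w -> inspan (fcat L one) c.
  elim: w c => [|w IHw] c; first exact: inspan_fcat_mem.
  move=> /allpairsP[[s d] /= [sL /IHw dL ->]].
  have {}sL : inspan (fcat L one) s by apply: inspan_fcat_mem.
  by do 3?[apply: inspanM] => //; apply: inspanV.
have chainL w n c : c \in comms_chain w n -> inspan (fcat L one) c.
  by elim: n w => //= n IHn w; rewrite mem_cat => /orP[/weightL | /IHn].
apply: (@wp_nth _ (fcat ts one)).
  move=> g gL; apply: inspan_fcat_mem; rewrite /ts; case: k k0 {law ts chts} => // k _.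
  by rewrite mem_cat gL.
apply: (@wp_fcat _ (inspan (fcat L one))); first exact: wp_one.
- move=> g _; exists (fun=> [::]); first exact: computable_const.
  by move=> i; rewrite weval_nil conj1g.
- by move=> t /chainL tL; split=> //; apply: inspanV.
- exact: central_chain_normal_chain.
Qed.

End Nilpotent.

(** * Commuting families with scaling *)

(** Induction on the list of coordinates. Let [B0] be a basis for the remaining coordinates and m
    the maximum of f on it: points with f at least m lie above a member of [B0], and each of the
    finitely many slices f = v < m has a finite basis by induction. *)
Lemma dickson (T : eqType) (fs : seq (T -> nat)) (E : set T) :
  exists2 B : seq T, (forall b, b \in B -> E b) &
    forall x, E x -> exists2 b, b \in B & all (fun f => f b <= f x) fs.
Proof.
elim: fs E => [|f fs IHfs] E.
  have [[x0 Ex0]|noE] := pselect (exists x, E x); last first.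
    by exists [::] => // x Ex; case: noE; exists x.
  by exists [:: x0] => [b|x _]; [rewrite inE => /eqP-> | exists x0; rewrite ?inE].
have [B0 B0E B0P] := IHfs E.
have /choice[B BP] v : exists B : seq T, (forall b, b \in B -> E b /\ f b = v) /\
    forall x, E x -> f x = v -> exists2 b, b \in B & all (fun f => f b <= f x) fs.
  have [B BE BP] := IHfs (fun x => E x /\ f x = v).
  by exists B; split=> // x Ex fx; apply: BP.
pose m := \max_(b <- B0) f b.
exists (B0 ++ flatten [seq B v | v <- iota 0 m]) => [b|x Ex].
  rewrite mem_cat => /orP[/B0E//|/flatten_mapP[v _ /(BP v).1[]//]].
case: (leqP m (f x)) => [mx|xm].
  have [b bB0 bx] := B0P x Ex; exists b; first by rewrite mem_cat bB0.
  by rewrite /= bx andbT; apply: leq_trans mx; apply: leq_bigmax_seq.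
have [b bB bx] := (BP (f x)).2 x Ex erefl; exists b.
  rewrite mem_cat; apply/orP; right; apply/flatten_mapP; exists (f x) => //.
  by rewrite mem_iota.
by rewrite /= bx ((BP _).1 b bB).2 leqnn.
Qed.

Lemma dvdn_logn (ps : seq nat) a b : 0 < a -> 0 < b ->
  {subset primes a <= ps} -> (forall p, p \in ps -> logn p a <= logn p b) ->
  a %| b.
Proof.
move=> a0 b0 aps ab; apply/(dvdn_partP _ a0) => p pa.
have {}pa : p \in primes a by [].
have p_pr : prime p by move: pa; rewrite mem_primes => /and3P[].
by rewrite p_part pfactor_dvdn // ab // aps.
Qed.

(** * Reduction of words by a strong Groebner basis *)

Section Graded.
Local Open Scope group_scope.
Variables (G : groupType) (t : nat -> G) (D : pred nat).
Hypothesis tC : forall i j, commute (t i) (t j).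
Hypothesis cD : computable D.
Hypothesis tD : forall k, ~~ D k -> t k = 1.
Hypothesis D_gt0 : forall k, D k -> 0 < k.
(** Multiplying indices by k / k0 is multiplication by a monomial. One element h realises it on all
    [t v] by conjugation, so relations are carried to relations. *)
Hypothesis t_scale : forall k0 k, D k0 -> D k -> k0 %| k ->
  exists h, forall v, t v ^ h = t (k %/ k0 * v).
Implicit Types (s u : seq nat) (g h : G) (k : nat).

Definition letters_lt k s := all (fun l => l./2 < k) s.

(** Indices are ordered as natural numbers, which is the monomial order of the reduction. *)
Definition inspan_lt k g := exists2 s, letters_lt k s & g = weval t s.

Lemma letters_lt_winv k s : letters_lt k (winv s) = letters_lt k s.
Proof.
rewrite /letters_lt /winv all_rev all_map; apply: eq_all => l /=.
congr (_ < _); rewrite -[l]odd_double_half; case: (odd l); rewrite /linv /= odd_double /=;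
  by rewrite add0n uphalf_double doubleK.
Qed.

Lemma inspan_lt_subgroup k : is_subgroup (inspan_lt k).
Proof.
split=> [|_ _ [s sk ->] [u uk ->]|_ [s sk ->]].
- by exists [::]; rewrite ?weval_nil.
- by exists (s ++ u); rewrite ?weval_cat // /letters_lt all_cat; apply/andP.
- by exists (winv s); rewrite ?weval_winv ?letters_lt_winv.
Qed.

Definition wscale q s : seq nat := [seq (q * l./2).*2 + odd l | l <- s]%N.

Lemma weval_scale x q s : weval x (wscale q s) = weval (fun v => x (q * v)%N) s :> G.
Proof.
elim: s => [|l s IHs]; first by rewrite !weval_nil.
rewrite /= !weval_cons IHs; congr (_ * _); rewrite {2}/leval.
by case: (odd l); rewrite ?addn1 ?addn0 ?leval_doubleS ?leval_double.
Qed.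

(** Compatibility of the monomial order with multiplication. *)
Lemma letters_lt_scale q k s : 0 < q -> letters_lt k s -> letters_lt (q * k) (wscale q s).
Proof.
move=> q0; rewrite /letters_lt /wscale all_map; apply: sub_all => l /= lk.
by rewrite addnC half_bit_double ltn_pmul2l.
Qed.

Lemma commute_weval g s : (forall k, commute g (t k)) -> commute g (weval t s).
Proof.
move=> gt; elim: s => [|l s IHs]; first by rewrite weval_nil; apply: commute1.
rewrite weval_cons; apply: commuteM => //; rewrite /leval.
by case: (odd l) => //; apply: commuteV.
Qed.

(** Since the family commutes, the letters of index k can be collected in front and cancelled
    against each other. *)
Lemma weval_split k u :
  weval t u = t k ^+ (size [seq l <- u | l == k.*2] - size [seq l <- u | l == k.*2.+1])
            * t k ^- (size [seq l <- u | l == k.*2.+1] - size [seq l <- u | l == k.*2])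
            * weval t [seq l <- u | l./2 != k].
Proof.
have [<- _] := expg_cancel (t k) (size [seq l <- u | l == k.*2])
                              (size [seq l <- u | l == k.*2.+1]).
elim: u => [|l u IHu]; first by rewrite /= !expg0 invg1 !mul1g.
rewrite weval_cons IHu /=; set a := size _; set b := size _; set w := [seq _ <- u | _].
have Ct m : commute (t m) (t k ^+ a * t k ^- b).
  by apply: commuteM; [|apply: commuteV]; apply: commuteX; apply: tC.
rewrite -[l]odd_double_half; case: (odd l); rewrite ?add1n ?add0n /= ?eqSS.
- rewrite uphalf_double leval_doubleS; have -> : (l./2.*2.+1 == k.*2) = false.
    by apply/negP => /eqP/(congr1 odd); rewrite /= !odd_double.
  rewrite (inj_eq double_inj); case: eqP => [->|_] /=.
    have E : t k ^- b.+1 = (t k)^-1 * t k ^- b by rewrite expgSr invgM.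
    rewrite E !mulgA; congr (_ * _ * _); apply: commute_sym; apply: commuteV.
    exact/commute_sym/commuteX.
  rewrite weval_cons leval_doubleS !mulgA; congr (_ * _).
  by rewrite -/a -/b -mulgA; apply: commute_sym; apply: commuteV; apply: commute_sym.
- rewrite doubleK leval_double (inj_eq double_inj).
  have -> : (l./2.*2 == k.*2.+1) = false.
    by apply/negP => /eqP/(congr1 odd); rewrite /= !odd_double.
  case: eqP => [->|_] /=; first by rewrite expgS !mulgA.
  by rewrite weval_cons leval_double !mulgA -/a -/b -(Ct l./2) !mulgA.
Qed.

Variables (B : seq nat) (m : nat -> nat) (rho : nat -> seq nat).

(* Cancels the letters t_k^{+-1}, using the relation t_b^(m b) = rho b of a
   generator b dividing k; the flag becomes false when this is impossible. *)
Definition reduce_step k (st : bool * seq nat) : bool * seq nat :=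
  let cp := size [seq l <- st.2 | l == k.*2] in
  let cn := size [seq l <- st.2 | l == k.*2.+1] in
  let u := [seq l <- st.2 | l./2 != k] in
  if ~~ D k || (cp == cn) then (st.1, u) else
  foldr (fun b r => if [&& b %| k, m b %| cp - cn & m b %| cn - cp] then
      let w := wscale (k %/ b) (rho b) in
      (st.1, u ++ flatten (nseq ((cp - cn) %/ m b) w) ++
             flatten (nseq ((cn - cp) %/ m b) (winv w)))
    else r) (false, u) B.

(** One more than the sum of the letters bounds every index in the word. Indices are treated in
    decreasing order, because rewriting t_k introduces only smaller ones. *)
Definition reduce s : bool :=
  let K := (foldr (fun l n => l + n)%N 0 s).+1 in
  (foldl (fun st k => reduce_step k st) (true, s) (rev (iota 0 K))).1.

Lemma computable_reduce : computable reduce.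
Proof.
have cstep : computable (fun p : nat * (bool * seq nat) => reduce_step p.1 p.2).
  rewrite /reduce_step.
  have cp : computable (fun p : nat * (bool * seq nat) =>
    size [seq l <- p.2.2 | l == p.1.*2]) by computable.
  have cn : computable (fun p : nat * (bool * seq nat) =>
    size [seq l <- p.2.2 | l == p.1.*2.+1]) by computable.
  have cu : computable (fun p : nat * (bool * seq nat) =>
    [seq l <- p.2.2 | l./2 != p.1]) by computable.
  apply: computable_if; [by computable|by computable|].
  (* The list [B] is fixed, so the search unfolds into nested conditionals in which [m b] and
     [rho b] are constants. *)
  elim: B => [|b B' IHB]; first by rewrite /=; computable.
  have cw : computable (fun p : nat * (bool * seq nat) => wscale (p.1 %/ b) (rho b)).
    by rewrite /wscale; computable.
  have ciw := computable_comp computable_winv cw.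
  by rewrite /=; computable.
rewrite /reduce; apply: computable_fst.
apply: (computable_foldl (g := fun _ st k => reduce_step k st)).
- by computable.
- exact: (computable_comp cstep (computable_pair (computable_snd (computable_snd
   computable_id)) (computable_fst (computable_snd computable_id)))).
- exact: (computable_pair (computable_const true) computable_id).
Qed.

Hypothesis mP : forall k e, inspan_lt k (t k ^+ e) <-> m k %| e.
Hypothesis rhoP : forall k, letters_lt k (rho k) /\ t k ^+ m k = weval t (rho k).
Hypothesis BD : forall b, b \in B -> D b.
Hypothesis BP : forall k, D k -> 0 < m k ->
  exists b, [/\ b \in B, b %| k & m b = m k].

(** Conjugating the relation t_b^(m b) = rho b by the element that scales by k / b gives a relation
    for t_k with smaller terms. *)
Lemma scale_relation b k : D b -> D k -> b %| k ->
  letters_lt k (wscale (k %/ b) (rho b)) /\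
  weval t (wscale (k %/ b) (rho b)) = t k ^+ m b.
Proof.
move=> Db Dk bk; have [lt_rho rhoE] := rhoP b.
have [h hE] := t_scale Db Dk bk; split.
  rewrite -{1}(divnK bk); apply: letters_lt_scale lt_rho.
  by rewrite divn_gt0 ?D_gt0 // dvdn_leq ?D_gt0.
rewrite weval_scale; have -> : (fun v => t (k %/ b * v)%N) = (fun v => t v ^ h).
  by apply/funext => v; rewrite hE.
by rewrite weval_conj -rhoE conjXg hE divnK.
Qed.

Lemma letters_lt_filter k u :
  letters_lt k.+1 u -> letters_lt k [seq l <- u | l./2 != k].
Proof.
move=> /allP lt_u; apply/allP => l; rewrite mem_filter => /andP[lk /lt_u].
by rewrite ltnS leq_eqVlt (negbTE lk).
Qed.

Lemma reduce_step_correct k st : letters_lt k.+1 st.2 ->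
  letters_lt k (reduce_step k st).2 /\
  (reduce_step k st).1 && (weval t (reduce_step k st).2 == 1) =
  st.1 && (weval t st.2 == 1).
Proof.
case: st => ok u /= lt_u; rewrite /reduce_step /= (weval_split k u).
have lt_f := letters_lt_filter lt_u; set f := [seq l <- u | l./2 != k] in lt_f *.
set cp := size [seq l <- u | l == k.*2]; set cn := size [seq l <- u | l == k.*2.+1].
have [_ t1] := expg_cancel (t k) cp cn.
case: ifP => [/orP[ntDk|/eqP->]|/norP[]].
- by rewrite tD // !expg1n invg1 !mul1g.
- by rewrite subnn expg0 invg1 !mul1g.
rewrite negbK => Dk cpn.
pose good b := [&& b %| k, m b %| cp - cn & m b %| cn - cp].
(* If no basis relation applies, the word is not trivial. Otherwise the power of t_k would lie in
   the span of lower terms, so its nonzero exponent would be a multiple of m k > 0, and the b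
   supplied by [BP] would apply. *)
have [hasB|noB] := boolP (has good B); last first.
  set r := foldr _ _ _; have -> : r = (false, f).
    rewrite /r; elim: B noB => //= b B' IHB.
    by rewrite negb_or /good => /andP[/negbTE-> /IHB].
  split=> //=; symmetry; apply/negP => /andP[_ /eqP u1].
  have span_t : inspan_lt k (t k ^+ (cp - cn) * t k ^- (cn - cp)).
    rewrite -[X in inspan_lt k X]invgK (mulg1_eq u1); exists (winv f).
      by rewrite letters_lt_winv.
    by rewrite weval_winv.
  have [mp mn] : m k %| cp - cn /\ m k %| cn - cp.
    have [s1 sM sV] := inspan_lt_subgroup k.
    case: t1 span_t => t1; rewrite t1 ?invg1 ?mul1g ?mulg1 => span_t; split; apply/mP.
    - by rewrite t1.
    - by rewrite -[t k ^+ _]invgK; apply: sV.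
    - by [].
    - by rewrite t1.
  have mk : 0 < m k.
    rewrite lt0n; apply: contra cpn => /eqP m0; move: mp mn; rewrite m0 !dvd0n.
    by rewrite !subn_eq0 eqn_leq => -> ->.
  have [b [bB bk bm]] := BP Dk mk.
  by move/hasPn: noB => /(_ b bB); rewrite /good bk bm mp mn.
have [b [bB /and3P[bk mp mn] ->]] : exists b, [/\ b \in B, good b &
    foldr (fun b r => if good b then (ok, f ++
      flatten (nseq ((cp - cn) %/ m b) (wscale (k %/ b) (rho b))) ++
      flatten (nseq ((cn - cp) %/ m b) (winv (wscale (k %/ b) (rho b)))))
    else r) (false, f) B = (ok, f ++
      flatten (nseq ((cp - cn) %/ m b) (wscale (k %/ b) (rho b))) ++
      flatten (nseq ((cn - cp) %/ m b) (winv (wscale (k %/ b) (rho b)))))].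
  elim: B hasB => //= b B' IHB; have [gb _|_ /= /IHB[b' [b'B gb' ->]]] := boolP (good b).
    by exists b; rewrite mem_head.
  by exists b'; rewrite inE b'B orbT.
have [lt_w wE] := scale_relation (BD bB) Dk bk.
have lt_nseq w i : letters_lt k w -> letters_lt k (flatten (nseq i w)).
  by move=> lt_w'; elim: i => //= i IHi; rewrite /letters_lt all_cat; apply/andP.
split.
  rewrite /letters_lt !all_cat; apply/and3P; split=> //; apply: lt_nseq => //.
  by rewrite letters_lt_winv.
rewrite /= !weval_cat !weval_nseq weval_winv wE expVgn -!expgnA.
rewrite ![(m b * _)%N]mulnC !divnK //.
congr (_ && (_ == 1)); apply: commute_sym; apply: commute_weval => i.
apply/commute_sym/commuteM; last apply: commuteV; apply: commuteX; exact: tC.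
Qed.

(** Each step preserves the conjunction of the flag with triviality of the word. At bound 0 the word
    is empty, and the flag alone is the answer. *)
Lemma reduceE s : reduce s = (weval t s == 1).
Proof.
rewrite /reduce; set K := _.+1.
have lt_s : letters_lt K s.
  rewrite /K; elim: s {K} => //= l s IHs; apply/andP; split.
    by rewrite ltnS -divn2 (leq_trans (leq_div _ _)) ?leq_addr.
  apply: sub_all IHs => i; move/leq_trans; apply; by rewrite ltnS leq_addl.
rewrite -[RHS]/((true, s).1 && (weval t (true, s).2 == 1)).
have {lt_s} : letters_lt K (true, s).2 by [].
move: K (true, s) => {s} K st; elim: K st => [|K IHK] st lt_st.
  rewrite /=; case: st lt_st => ok [|l u] //= _.
  by rewrite weval_nil eqxx andbT.
have [lt_r <-] := reduce_step_correct lt_st.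
by rewrite -[K.+1]addn1 iotaD rev_cat /= IHK.
Qed.

End Graded.

(* A strong Groebner basis argument: order the monomials by their index. If
   m k is the order of t_k modulo the span of the previous elements, then m k
   divides m b whenever b divides k, so by Dickson's lemma finitely many of the
   relations t_k^(m k) = rho k suffice to reduce every word. *)
Lemma wp_graded (G : groupType) (t : nat -> G) (D : pred nat) (ps : seq nat) :
  (forall i j, commute (t i) (t j)) -> computable D ->
  (forall k, ~~ D k -> t k = 1)%g -> (forall k, D k -> 0 < k) ->
  (forall k, D k -> {subset primes k <= ps}) ->
  (forall k0 k, D k0 -> D k -> k0 %| k ->
     exists h, forall v, (t v ^ h = t (k %/ k0 * v)%N)%g) ->
  wp t.
Proof.
move=> tC cD tD D_gt0 D_primes t_scale.
have /choice[m mP] k := expg_mod_subgroup (t k) (inspan_lt_subgroup t k).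
have /choice[rho rhoP] k : exists s, letters_lt k s /\ (t k ^+ m k = weval t s)%g.
  by have [_ /(_ (dvdnn _))[s ? ?]] := mP k (m k); exists s.
(* The coordinates are [m] and the valuations at [ps]. A basis element b below k divides k and has m
   b <= m k; scaling its relation shows that m k divides m b, so both are equal. *)
have [B BE BP] := dickson (m :: [seq logn p | p <- ps]) [set k | D k /\ 0 < m k].
have BD b : b \in B -> D b by case/BE.
have {}BP k : D k -> 0 < m k -> exists b, [/\ b \in B, b %| k & m b = m k].
  move=> Dk mk; have [b bB /= /andP[le_m le_log]] := BP k (conj Dk mk).
  have Db := BD b bB.
  have bk : b %| k.
    apply: (dvdn_logn (D_gt0 _ Db) (D_gt0 _ Dk) (D_primes _ Db)) => p pps.
    by move: le_log; rewrite all_map => /allP/(_ p pps).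
  exists b; split=> //; apply/eqP; rewrite eqn_leq le_m /=.
  apply: dvdn_leq; first by case: (BE b bB).
  apply/mP; have [lt_w wE] := scale_relation D_gt0 t_scale rhoP Db Dk bk.
  by exists (wscale (k %/ b) (rho b)).
apply: eq_computable (computable_reduce cD B m rho) => s.
exact: (reduceE tC tD D_gt0 t_scale mP rhoP BD BP).
Qed.

(** * Metabelian groups *)

Lemma prime_sequence : exists2 pr : nat -> nat, (forall i, prime (pr i)) & injective pr.
Proof.
pose pr n := iter n (fun p => s2val (prime_above p)) 2.
exists pr => [[|i]|i j]; rewrite /pr //=; first by case: prime_above.
have pr_lt : {homo pr : i j / i < j}.
  apply: homo_ltn => [? ? ?|n]; first exact: ltn_trans.
  by rewrite /pr /=; case: prime_above.
by case: (ltngtP i j) => // /pr_lt + eq_pr; rewrite /pr eq_pr ltnn.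
Qed.

Section Metabelian.
Local Open Scope group_scope.
Variables (G : groupType) (L : seq G).
Hypothesis law : forall a b c d : G, commute (comm a b) (comm c d).
Hypothesis LV : forall g, g \in L -> g^-1 \in L.

Definition is_comm (b : G) := exists a c, b = comm a c.

Lemma is_commJ b g : is_comm b -> is_comm (b ^ g).
Proof.
move=> [a [c ->]]; exists (a ^ g), (c ^ g).
by rewrite /comm -!conjVg -!conjMg.
Qed.

(** The two conjugates differ by conjugation with [g, h], which commutes with every commutator.
    Hence conjugations by the members of [L] act on commutators as commuting variables of a
    polynomial ring. *)
Lemma conj_swap b g h : is_comm b -> b ^ (g * h) = b ^ (h * g).
Proof.
move=> cb; rewrite (commgC g h) conjgM.
have [a [c ->]] := is_commJ (h * g) cb.
have -> : [~ g, h] = comm g^-1 h^-1 by rewrite /comm !invgK commgEl conjgE !mulgA.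
by apply/conjg_fixP/commgP/law.
Qed.

(** The factors need not commute in G, but acting on a commutator they can be permuted, so the
    additional factor moves to the end. *)
Lemma conj_prod_incr b (y : nat -> G) (e : nat -> nat) i s :
  is_comm b -> uniq s ->
  b ^ (\prod_(l <- s) y l ^+ ((l == i) + e l)) =
  b ^ ((\prod_(l <- s) y l ^+ e l) * (if i \in s then y i else 1)).
Proof.
elim: s b => [|l s IHs] b cb /=; first by rewrite !big_nil mulg1.
move=> /andP[ls us]; rewrite !big_cons inE eq_sym.
case: eqP => [->|_] /=; last first.
  by rewrite add0n !conjgM IHs ?conjgM //; apply: is_commJ.
rewrite add1n -mulgA expgSr -mulgA !(conjgM b); set c := b ^ _.
have cc : is_comm c by apply: is_commJ.
rewrite (conj_swap _ _ cc); congr (_ ^ (_ * _)).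
rewrite big_seq [RHS]big_seq; apply: eq_bigr => l' l's.
by case: eqP => // E; move: ls; rewrite -E l's.
Qed.

Variable pr : nat -> nat.
Hypothesis pr_prime : forall i, prime (pr i).
Hypothesis pr_inj : injective pr.

Let N := size L.
Let Bs : seq G := [seq comm a b | a <- L, b <- L].
Let M := size Bs.

Definition smooth n := 0 < n /\ forall p, prime p -> p %| n -> exists2 i, i < N & p = pr i.

(** The primes [pr i] with i < N stand for conjugation by the members of [L], so smooth numbers are
    monomials in these variables. The prime [pr (N + j)] marks the j-th commutator in [Bs] as a
    generator of the module. *)
Definition monomial k j n := [/\ j < M, smooth n & k = pr (N + j) * n]%N.

Lemma smooth_dvd n d : d %| n -> smooth n -> smooth d.
Proof.
move=> dn [n0 np]; split=> [|p p_pr pd]; first exact: dvdn_gt0 dn.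
by apply: np => //; apply: dvdn_trans dn.
Qed.

Lemma pr_dvd i j : (pr i %| pr j) = (i == j).
Proof. by rewrite dvdn_prime2 // (inj_eq pr_inj). Qed.

Lemma smooth_pr j n : smooth n -> ~~ (pr (N + j) %| n).
Proof.
move=> [_ np]; apply/negP => /(np _ (pr_prime _))[i iN /pr_inj E].
by move: iN; rewrite -E ltnNge leq_addr.
Qed.

(** The marking prime divides no smooth number, so monomials at different module generators never
    divide one another. *)
Lemma monomial_dvd k0 j0 n0 k j n :
  monomial k0 j0 n0 -> monomial k j n -> k0 %| k -> j0 = j /\ n0 %| n.
Proof.
move=> [_ n0s ->] [_ ns ->] dvd.
have E : j0 = j.
  have: pr (N + j0) %| (pr (N + j) * n)%N by apply: dvdn_trans dvd; apply: dvdn_mulr.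
  rewrite Euclid_dvdM // (negbTE (smooth_pr _ ns)) orbF pr_dvd eqn_add2l.
  by move/eqP.
by split=> //; move: dvd; rewrite E dvdn_pmul2l // prime_gt0.
Qed.

Lemma monomial_inj k j n j' n' : monomial k j n -> monomial k j' n' -> j = j' /\ n = n'.
Proof.
move=> m m'; have [E d] := monomial_dvd m m' (dvdnn _).
have [_ d'] := monomial_dvd m' m (dvdnn _); split=> //.
by apply/eqP; rewrite eqn_dvd d d'.
Qed.

Lemma monomial_scale i k j n :
  i < N -> monomial k j n -> monomial (pr i * k)%N j (pr i * n)%N.
Proof.
move=> iN [jM [n0 np] ->]; split=> //; last by rewrite mulnCA.
split=> [|p p_pr]; first by rewrite muln_gt0 prime_gt0.
rewrite Euclid_dvdM // => /orP[|/np]; last exact.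
by rewrite dvdn_prime2 // => /eqP->; exists i.
Qed.

(** Multiplication by a variable does not lead from outside the support into it; there the family is
    1 before and after scaling. *)
Lemma monomial_unscale i k j n :
  i < N -> monomial (pr i * k)%N j n -> exists n', monomial k j n'.
Proof.
move=> iN [jM ns E].
have: pr i %| n.
  have: pr i %| (pr (N + j) * n)%N by rewrite -E dvdn_mulr.
  rewrite Euclid_dvdM // pr_dvd; case: eqP => //= E'.
  by move: iN; rewrite E' ltnNge leq_addr.
move=> /dvdnP[n' En]; exists n'; split=> //.
  by apply: smooth_dvd ns; rewrite En dvdn_mulr.
apply/eqP; rewrite -(eqn_pmul2l (prime_gt0 (pr_prime i))) E En.
by rewrite [X in _ == X]mulnCA [X in _ == (_ * X)%N]mulnC.
Qed.

Definition support k : bool := `[< exists j n, monomial k j n >].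

(** The element through which the monomial n acts by conjugation: the valuations of n are the
    exponents of the variables. The order of the factors is immaterial on commutators. *)
Definition act n : G := \prod_(l <- iota 0 N) nth 1 L l ^+ logn (pr l) n.

Lemma act_scale b i n : is_comm b -> i < N -> 0 < n ->
  b ^ act (pr i * n)%N = (b ^ act n) ^ nth 1 L i.
Proof.
move=> cb iN n0; rewrite -conjgM /act.
have -> : \prod_(l <- iota 0 N) nth 1 L l ^+ logn (pr l) (pr i * n) =
    \prod_(l <- iota 0 N) nth 1 L l ^+ ((l == i) + logn (pr l) n).
  apply: eq_bigr => l _; rewrite lognM // ?prime_gt0 // logn_prime //.
  by rewrite (inj_eq pr_inj).
rewrite (conj_prod_incr (nth 1 L) (fun l => logn (pr l) n)) ?iota_uniq //.
by rewrite mem_iota iN.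
Qed.

Lemma monomial_family : exists t : nat -> G,
  (forall k j n, monomial k j n -> t k = nth 1 Bs j ^ act n) /\
  (forall k, ~~ support k -> t k = 1).
Proof.
suff /choice[t tP] : forall k, exists g : G,
    (forall j n, monomial k j n -> g = nth 1 Bs j ^ act n) /\
    (~~ support k -> g = 1).
  by exists t; split=> k; case: (tP k).
move=> k; have [[j [n m]]|nm] := pselect (exists j n, monomial k j n).
  exists (nth 1 Bs j ^ act n); split=> [j' n' m'|].
    by have [-> ->] := monomial_inj m m'.
  by move/negP; case; apply/asboolP; exists j, n.
by exists 1; split=> // j n m; case: nm; exists j, n.
Qed.

(** A divisor n of k is smooth iff it divides Q^k, where Q is the product of the primes of the
    variables: the exponent k is large enough, as the valuations of n are less than n. *)
Lemma computable_support : computable support.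
Proof.
pose Q := (\prod_(i <- iota 0 N) pr i)%N.
pose test (qs : seq nat) k := has (fun q => (0 < k) && (q %| k) && (k %/ q %| Q ^ k)%N) qs.
have ctest qs : computable (test qs).
  rewrite /test; elim: qs => [|q qs IHqs] /=; first exact: computable_const.
  by computable.
have prQ i : i < N -> pr i %| Q.
  by move=> iN; rewrite /Q (big_rem i) ?mem_iota //= dvdn_mulr.
have Qpr p : prime p -> p %| Q -> exists2 i, i < N & p = pr i.
  move=> p_pr; rewrite /Q big_seq.
  elim/big_ind: _ => [|a b IHa IHb|i].
  - by rewrite dvdn1 => /eqP E; move: p_pr; rewrite E.
  - by rewrite Euclid_dvdM // => /orP[].
  - by rewrite mem_iota => /andP[_ iN]; rewrite dvdn_prime2 // => /eqP->; exists i.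
have Q0 : 0 < Q.
  by rewrite /Q big_seq; apply: prodn_cond_gt0 => i _; apply: prime_gt0.
apply: eq_computable (ctest [seq pr (N + j) | j <- iota 0 M]) => k.
apply/hasP/asboolP => [[_ /mapP[j jM ->] /andP[/andP[k0 qk] dQ]]|[j [n [jM ns ->]]]].
  exists j, (k %/ pr (N + j)); split; last by rewrite mulnC divnK.
    by move: jM; rewrite mem_iota.
  split=> [|p p_pr pd]; first by rewrite divn_gt0 ?prime_gt0 // dvdn_leq.
  apply: Qpr => //; move: (dvdn_trans pd dQ); rewrite Euclid_dvdX //.
  by case/andP.
have [n0 np] := ns; have p0 := prime_gt0 (pr_prime (N + j)).
exists (pr (N + j)); first by apply/mapP; exists j; rewrite ?mem_iota.
rewrite muln_gt0 p0 n0 dvdn_mulr //= mulKn //.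
apply: (@dvdn_logn (primes n)) => // [|p]; first by rewrite expn_gt0 Q0.
rewrite mem_primes => /and3P[p_pr _ pn]; rewrite lognX.
have [i iN Ep] := np _ p_pr pn.
apply: leq_trans (_ : n <= _); first exact/ltnW/ltn_logl.
apply: leq_trans (leq_pmull n p0) _; apply: leq_pmulr.
by rewrite logn_gt0 mem_primes p_pr Q0 Ep prQ.
Qed.

Lemma wp_monomials : exists t : nat -> G, [/\ wp t,
  forall i k, i < N -> t k ^ nth 1 L i = t (pr i * k)%N &
  forall a b, a \in L -> b \in L -> inspan t (comm a b)].
Proof.
have [t [tE t1]] := monomial_family; exists t.
have Bcomm j : is_comm (nth 1 Bs j).
  case: (ltnP j M) => [jM|jM]; last first.
    by rewrite nth_default //; exists 1, 1; rewrite /comm !invg1 !mulg1.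
  by have /allpairsP[[a b] [_ _ ->]] := mem_nth 1 jM; exists a, b.
have tcomm k : is_comm (t k).
  have [/asboolP[j [n m]]|/t1->] := boolP (support k).
    by rewrite (tE _ _ _ m); apply: is_commJ.
  by exists 1, 1; rewrite /comm !invg1 !mulg1.
have tscale i k : i < N -> t k ^ nth 1 L i = t (pr i * k)%N.
  move=> iN; have [/asboolP[j [n m]]|nk] := boolP (support k).
    rewrite (tE _ _ _ m) (tE _ _ _ (monomial_scale iN m)) act_scale //.
    by have [_ []] := m.
  rewrite !t1 ?conj1g //; apply: contra nk => /asboolP[j [n m]].
  by apply/asboolP; have [n' m'] := monomial_unscale iN m; exists j, n'.
(* A smooth number is split into primes one at a time, and the corresponding members of [L] are
   multiplied up. *)
have tsmooth q : smooth q -> exists h, forall v, t v ^ h = t (q * v)%N.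
  have [r] := ubnP q; elim: r q => // r IHr q; rewrite ltnS => qr qs.
  have [q0 qp] := qs; case: (ltngtP q 1) => [|q1|->]; first by case: q q0 {qs qp qr}.
    have [i iN E] := qp _ (pdiv_prime q1) (pdiv_dvd q).
    have Eq : q = (pr i * (q %/ pr i))%N by rewrite mulnC divnK // -E pdiv_dvd.
    have [||h hE] := IHr (q %/ pr i).
    - by apply: leq_trans qr; apply: ltn_Pdiv => //; apply: prime_gt1.
    - by apply: smooth_dvd qs; rewrite {2}Eq dvdn_mull.
    exists (h * nth 1 L i) => v; rewrite conjgM hE tscale //.
    by rewrite mulnA -Eq.
  by exists 1 => v; rewrite conjg1 mul1n.
split=> //.
  apply: (@wp_graded _ t support [seq pr i | i <- iota 0 (N + M)]).
  - move=> i j; have [a [b ->]] := tcomm i; have [c [d ->]] := tcomm j; exact: law.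
  - exact: computable_support.
  - exact: t1.
  - by move=> k /asboolP[j [n [_ [n0 _] ->]]]; rewrite muln_gt0 prime_gt0.
  - move=> k /asboolP[j [n [jM [n0 np] ->]]] p.
    rewrite mem_primes => /and3P[p_pr _]; rewrite Euclid_dvdM // => /orP[|/np].
      rewrite dvdn_prime2 // => /eqP->; apply: map_f.
      by rewrite mem_iota ltn_add2l.
    move=> /(_ p_pr)[i iN ->]; apply: map_f; rewrite mem_iota.
    by rewrite (leq_trans iN) ?leq_addr.
  - move=> k0 k /asboolP[j0 [n0 m0]] /asboolP[j [n m]] dvd.
    have [E d] := monomial_dvd m0 m dvd.
    have [_ ns _] := m; have [_ [n00 _] _] := m0.
    have -> : k %/ k0 = n %/ n0.
      have [_ _ ->] := m; have [_ _ ->] := m0.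
      by rewrite E divnMl // prime_gt0.
    by apply: tsmooth; apply: smooth_dvd ns; apply: dvdn_div.
move=> a b aL bL; have cB : comm a b \in Bs by apply/allpairsP; exists (a, b).
(* The commutators themselves are the monomials with n = 1, on which [act] is trivial. *)
have m : monomial (pr (N + index (comm a b) Bs)) (index (comm a b) Bs) 1.
  split; rewrite ?index_mem ?muln1 //; split=> // p p_pr.
  by rewrite dvdn1 => /eqP E; move: p_pr; rewrite E.
have -> : comm a b = t (pr (N + index (comm a b) Bs)).
  rewrite (tE _ _ _ m) nth_index // /act big1 ?conjg1 // => l _.
  by rewrite logn1 expg0.
exact: inspan_gen.
Qed.

(** For g and h in [L], the conjugate g^h equals [h^-1, g] g, and the commutator lies in the span of
    [t]. So the members of [L] can be adjoined one after the other. *)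
Lemma wp_metabelian_closed : exists2 y : nat -> G, wp y & forall g, g \in L -> inspan y g.
Proof.
have [t [wpt tscale tcomm]] := wp_monomials.
exists (fcat L t); last by move=> g; apply: inspan_fcat_mem.
apply: (@wp_fcat _ [set g | g \in L]) => //.
- move=> g gL; exists (fun k => [:: (pr (index g L) * k).*2]); first by computable.
  by move=> k; rewrite weval1 leval_double -tscale ?index_mem // nth_index.
- by move=> g gL; split; last exact: LV.
(* Only the chain is generalised, to any list [ts] of members of [L]; the set of conjugating
   elements remains [L]. *)
have : {subset L <= L} by [].
move: {1 4}L => ts; elim: ts => //= g ts IHts gtsL; split; last first.
  by apply: IHts => h hts; apply: gtsL; rewrite inE hts orbT.
move=> h hL; rewrite -[h]invgK -comm_mul; apply: inspanM.
  apply: (@inspan_fcat _ (g :: ts)); apply: tcomm; first exact: LV.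
  by apply: gtsL; apply: mem_head.
exact: (inspan_gen (fcons g _) 0).
Qed.

End Metabelian.

(** Adding the inverses makes the list closed under inversion; [wp_nth] then returns to [L]. *)
Lemma wp_metabelian (G : groupType) (L : seq G) :
  (forall a b c d : G, commute (comm a b) (comm c d)) -> wp (nth 1%g L).
Proof.
move=> law; have [pr pr_prime pr_inj] := prime_sequence.
have [|y wpy yL] := @wp_metabelian_closed _ (L ++ [seq g^-1%g | g <- L]) law _ pr pr_prime pr_inj.
  move=> g; rewrite !mem_cat => /orP[gL|/mapP[h hL ->]]; last by rewrite invgK hL.
  by rewrite map_f ?orbT.
by apply: wp_nth wpy => g gL; apply: yL; rewrite mem_cat gL.
Qed.

(** * Verbal products *)

Section Assembly.
Local Open Scope group_scope.
Local Open Scope classical_set_scope.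

(** * Homomorphisms and the coding of words *)

Section Homomorphisms.
Variables (G H : groupType) (f : G -> H).
Hypothesis fM : {morph f : x y / x * y}.

Lemma hom1 : f 1 = 1.
Proof. by apply: (mulgI (f 1)); rewrite -fM !mulg1. Qed.

Lemma homV x : f x^-1 = (f x)^-1.
Proof. by apply: (mulgI (f x)); rewrite -fM !mulgV hom1. Qed.

Lemma weval_hom (x : nat -> G) s : weval (f \o x) s = f (weval x s).
Proof.
elim: s => [|l s IHs]; first by rewrite !weval_nil hom1.
by rewrite !weval_cons fM IHs /leval /=; case: (odd l); rewrite ?homV.
Qed.

Lemma word_eval_hom X (x : X -> G) w : word_eval (f \o x) w = f (word_eval x w).
Proof.
rewrite /word_eval; elim: w => [|[i b] w IHw]; first by rewrite !big_nil hom1.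
by rewrite !big_cons fM IHw /letter_eval /=; case: b; rewrite ?homV.
Qed.

Lemma hom_comm x y : f (comm x y) = comm (f x) (f y).
Proof. by rewrite /comm !fM !homV. Qed.

Lemma nth_codom_hom n (x : 'I_n -> G) k :
  nth 1 (codom (f \o x)) k = f (nth 1 (codom x) k).
Proof.
rewrite /codom /image_mem (map_comp f x); case: (ltnP k (size (map x (enum 'I_n)))) => kn.
  by rewrite (nth_map 1).
by rewrite !nth_default ?hom1 ?(size_map f) //.
Qed.

End Homomorphisms.

Lemma nth_codom_ord (G : groupType) n (x : 'I_n -> G) (i : 'I_n) :
  nth 1 (codom x) i = x i.
Proof. by rewrite /codom /image_mem (nth_map i) ?size_enum_ord // nth_ord_enum. Qed.

Lemma word_eval_weval (G : groupType) n (x : 'I_n -> G) (w : word 'I_n) :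
  word_eval x w = weval (nth 1 (codom x)) [seq letter_code l | l <- w].
Proof.
elim: w => [|[i b] w IHw]; first by rewrite weval_nil /word_eval big_nil.
rewrite /= weval_cons -IHw /word_eval big_cons; congr (_ * _).
rewrite /letter_eval /letter_code /=; case: b.
  by rewrite addn1 leval_doubleS nth_codom_ord.
by rewrite addn0 leval_double nth_codom_ord.
Qed.

Lemma enc_code (s : seq nat) : enc s = CodeSeq.code s.
Proof. by []. Qed.

Lemma letter_code_surj n s : all (fun l => l < n.*2) s ->
  exists w : word 'I_n, [seq letter_code l | l <- w] = s.
Proof.
elim: s => [|l s IHs] /=; first by exists [::].
move=> /andP[ln /IHs[w <-]].
have l2 : l./2 < n by rewrite ltn_half_double.
exists ((Ordinal l2, odd l) :: w); congr (_ :: _).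
by rewrite /letter_code /= addnC odd_double_half.
Qed.

Lemma weval_filter (G : groupType) n (x : 'I_n -> G) s :
  weval (nth 1 (codom x)) [seq l <- s | l < n.*2] = weval (nth 1 (codom x)) s.
Proof.
elim: s => [|l s IHs] //=; case: ltnP => ln; rewrite !weval_cons IHs //.
have -> : leval (nth 1 (codom x)) l = 1; last by rewrite mul1g.
rewrite /leval nth_default ?invg1 ?if_same // size_codom card_ord.
by rewrite geq_half_double.
Qed.

(** Words over n letters are compared with arbitrary lists of naturals. Letters from 2n on evaluate
    to the default 1 and are filtered out. *)
Lemma decidable_word_problemP (G : groupType) :
  decidable_word_problem G <->
  exists n (x : 'I_n -> G), generated (range x) = setT /\ wp (nth 1 (codom x)).
Proof.
split=> -[n [x [genx]]]; last first.
  move=> [F [f Hf] HF]; exists n, x; split=> //; exists f => w.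
  have := Hf [tuple word_code w]; rewrite theadE /word_code -enc_code HF.
  by rewrite -word_eval_weval.
move=> [f Hf]; exists n, x; split=> //.
have [F [g Hg] HF] : computable (fun s : seq nat => [seq l <- s | l < n.*2]).
  by computable.
(* Every number is the code of a list, and filtering makes it the code of a word over n letters. The
   composite with the given algorithm therefore halts everywhere. *)
exists (fun k => nat_of_bool (weval (nth 1 (codom x)) (CodeSeq.decode k) == 1)).
  exists (RComp f (fun=> g)) => v /=.
  set s := CodeSeq.decode (thead v).
  have [w wE] := letter_code_surj (filter_all (fun l => l < n.*2) s).
  exists [tuple word_code w] => [i|].
    rewrite (tnth_nth 0) ord1 /= /word_code wE -enc_code -HF enc_code /s.
    rewrite CodeSeq.decodeK; exact: Hg.
  by rewrite -weval_filter -wE -word_eval_weval.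
by move=> s; rewrite enc_code CodeSeq.codeK.
Qed.

(** * Quotients by verbal subgroups *)

Section QuotientProjection.
Variables (G : groupType) (N : normalSubgroup G).

Lemma quotient_proj_morph : {morph @quotient_proj G N : x y / x * y}.
Proof. by move=> x y; rewrite -quotient_projM. Qed.

Lemma quotient_proj_eq1 x : quotient_proj N x = 1 <-> nsg_set N x.
Proof.
rewrite -[1]/(quotient_proj N 1) quotient_projP mulg1.
have [[_ _ NV] _] := nsg_normal N.
by split=> /NV; rewrite ?invgK.
Qed.

End QuotientProjection.

Lemma verbal_quotient_law (W : set (word nat)) (G : groupType) w
    (a : nat -> quotient_group (NormalSubgroup (verbal_subgroup_normal W G))) :
  W w -> word_eval a w = 1.
Proof.
move=> Ww; have -> : a = quotient_proj _ \o (fun k => repr (a k)).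
  by apply/funext => k /=; rewrite quotient_reprK.
rewrite (word_eval_hom (@quotient_proj_morph _ _)).
apply/quotient_proj_eq1 => H [_]; apply; exists w => //.
by exists (fun k => repr (a k)).
Qed.

Lemma wp_verbal_quotient (W : set (word nat)) (G : groupType)
    (L : seq (quotient_group (NormalSubgroup (verbal_subgroup_normal W G)))) :
  (exists k : nat, (1 <= k)%N /\ W = [set nil_word k]) \/ W = [set sol_word 2] ->
  wp (nth 1 L).
Proof.
have law := @verbal_quotient_law W G.
case=> [[k [k0 WE]]|WE].
  by apply: (@wp_nilpotent _ L k k0) => a; apply: law; rewrite WE.
apply: wp_metabelian => a b c d.
have Ws : W (sol_word 2) by rewrite WE.
(* Letters are numbered from 1, so index 0 is filled with 1. *)
have := law (sol_word 2) (nth 1 [:: 1; a; b; c; d]) Ws.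
rewrite /sol_word /= !word_eval_comm !word_eval1 /= => /eqP.
by rewrite {1}/comm divg_eq mul1g divg_eq => /eqP.
Qed.

(** * The free product and its projections to the factors *)

Section FreeProductLift.
Variables (A B H : groupType) (f : A -> H) (g : B -> H).
Hypotheses (fM : {morph f : x y / x * y}) (gM : {morph g : x y / x * y}).
Local Notation P := (free_product A B).

Definition fp_lift (p : P) : H :=
  \prod_(l <- repr p) match l with inl a => f a | inr b => g b end.

(** The product is invariant under each generating rule of the congruence, hence independent of the
    representative. *)
Lemma fp_liftE s : fp_lift (fp_proj s) =
  \prod_(l <- s) match l with inl a => f a | inr b => g b end.
Proof.
rewrite /fp_lift; move: (repr _) (fp_repr s) => s'; elim=> //= {s s'}.
- by move=> s t u _ -> _ ->.
- by move=> s s' u u' _ IHs _ IHu; rewrite !big_cat IHs IHu.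
- by move=> a a'; rewrite big_cons !big_seq1 fM.
- by move=> b b'; rewrite big_cons !big_seq1 gM.
- by rewrite big_seq1 big_nil hom1.
- by rewrite big_seq1 big_nil hom1.
Qed.

Lemma fp_liftM : {morph fp_lift : x y / x * y}.
Proof.
by move=> x y; rewrite -(fp_reprK x) -(fp_reprK y) [_ * _]fp_projM !fp_liftE big_cat.
Qed.

Lemma fp_lift_inl a : fp_lift (fp_inl B a) = f a.
Proof. by rewrite fp_liftE big_seq1. Qed.

Lemma fp_lift_inr b : fp_lift (fp_inr A b) = g b.
Proof. by rewrite fp_liftE big_seq1. Qed.

End FreeProductLift.

Section FreeProduct.
Variables A B : groupType.
Local Notation P := (free_product A B).

Lemma fp_inlM : {morph @fp_inl A B : x y / x * y}.
Proof. by move=> x y; rewrite [RHS]fp_projM; apply/fp_projP/fp_sym/fp_mull. Qed.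

Lemma fp_inrM : {morph @fp_inr A B : x y / x * y}.
Proof. by move=> x y; rewrite [RHS]fp_projM; apply/fp_projP/fp_sym/fp_mulr. Qed.

Definition fp_fst : P -> A := fp_lift id (fun=> 1).
Definition fp_snd : P -> B := fp_lift (fun=> 1) id.

Lemma fp_fstM : {morph fp_fst : x y / x * y}.
Proof. by apply: fp_liftM => // ? ?; rewrite mulg1. Qed.

Lemma fp_sndM : {morph fp_snd : x y / x * y}.
Proof. by apply: fp_liftM => // ? ?; rewrite mulg1. Qed.

Lemma fp_fst_inl a : fp_fst (fp_inl B a) = a.
Proof. by apply: fp_lift_inl => // ? ?; rewrite mulg1. Qed.

Lemma fp_fst_inr b : fp_fst (fp_inr A b) = 1.
Proof. by apply: fp_lift_inr => // ? ?; rewrite mulg1. Qed.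

Lemma fp_snd_inl a : fp_snd (fp_inl B a) = 1.
Proof. by apply: fp_lift_inl => // ? ?; rewrite mulg1. Qed.

Lemma fp_snd_inr b : fp_snd (fp_inr A b) = b.
Proof. by apply: fp_lift_inr => // ? ?; rewrite mulg1. Qed.

(* Modulo the cross commutators every p equals fst p * snd p. *)
Lemma cross_commutatorsP (p : P) :
  @cross_commutators A B p <-> fp_fst p = 1 /\ fp_snd p = 1.
Proof.
split=> [|[p1 p2]].
  move/(_ [set q | fp_fst q = 1 /\ fp_snd q = 1]); apply; split.
    split=> [|x y [x1 x2] [y1 y2]|x [x1 x2]] /=.
    - by rewrite (hom1 fp_fstM) (hom1 fp_sndM).
    - by rewrite fp_fstM fp_sndM x1 x2 y1 y2 !mulg1.
    - by rewrite (homV fp_fstM) (homV fp_sndM) x1 x2 !invg1.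
  move=> _ [a [b ->]] /=; rewrite (hom_comm fp_fstM) (hom_comm fp_sndM).
  rewrite fp_fst_inl fp_fst_inr fp_snd_inl fp_snd_inr /comm.
  by rewrite !invg1 !mulg1 !mul1g !mulgV.
pose N := NormalSubgroup (@cross_commutators_normal A B).
have qM := @quotient_proj_morph _ N.
apply/(quotient_proj_eq1 N).
suff E q : quotient_proj N q = quotient_proj N (fp_inl B (fp_fst q) * fp_inr A (fp_snd q)).
  by rewrite E p1 p2 (hom1 fp_inlM) (hom1 fp_inrM) mulg1 (hom1 qM).
rewrite -(fp_reprK q); elim: (repr q) => [|l s IHs].
  rewrite -[fp_proj [::]]/(1 : P) (hom1 fp_fstM) (hom1 fp_sndM).
  by rewrite (hom1 fp_inlM) (hom1 fp_inrM) mulg1.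
have -> : fp_proj (l :: s) = fp_proj [:: l] * fp_proj s by rewrite [RHS]fp_projM.
rewrite fp_fstM fp_sndM qM IHs fp_inlM fp_inrM !qM.
case: l => [a|b].
  rewrite -[fp_proj _]/(fp_inl B a) fp_fst_inl fp_snd_inl (hom1 fp_inrM) (hom1 qM).
  by rewrite mul1g mulgA.
rewrite -[fp_proj _]/(fp_inr A b) fp_fst_inr fp_snd_inr (hom1 fp_inlM) (hom1 qM) mul1g.
rewrite !mulgA; congr (_ * _).
set a := fp_fst _.
(* The letter b has to pass the A-component of the rest, with which it commutes modulo the cross
   commutators. *)
have /quotient_proj_eq1 : nsg_set N (comm (fp_inl B a) (fp_inr A b)).
  by move=> H [_ SH]; apply: SH; exists a, b.
rewrite (hom_comm qM) /comm => /eqP; rewrite divg_eq mul1g divg_eq => /eqP.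
by move=> ->.
Qed.

End FreeProduct.

(** * Generators and word problem of the verbal product *)

Section Main.
Variables (W : set (word nat)) (A B : groupType) (n m : nat).
Variables (x : 'I_n -> A) (y : 'I_m -> B).
Local Notation P := (free_product A B).
Local Notation V := (NormalSubgroup (@verbal_kernel_normal W A B)).
Local Notation Q := (NormalSubgroup (verbal_subgroup_normal W P)).

Definition fp_gens (i : 'I_(n + m)) : P :=
  match split i with inl j => fp_inl B (x j) | inr j => fp_inr A (y j) end.

Lemma verbal_product_generated :
  generated (range x) = setT -> generated (range y) = setT ->
  generated (range (quotient_proj V \o fp_gens)) = setT.
Proof.
move=> genx geny; apply/seteqP; split=> // v _; rewrite -(quotient_reprK v).
set S := generated _; have [S1 SM SV] : is_subgroup S by exact: generated_subgroup.
have qM := @quotient_proj_morph _ V.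
have Sgen i : S (quotient_proj V (fp_gens i)).
  by move=> H [_]; apply; exists i.
(* The preimage of [S] in each factor is a subgroup; it contains the generators of that factor,
   hence all of it. *)
have pull (C : groupType) (h : C -> P) (hM : {morph h : a b / a * b}) :
    is_subgroup [set c | S (quotient_proj V (h c))].
  split=> [|a b Sa Sb|a Sa] /=.
  - by rewrite (hom1 hM) (hom1 qM).
  - by rewrite hM qM; apply: SM.
  - by rewrite (homV hM) (homV qM); apply: SV.
have Sl a : S (quotient_proj V (fp_inl B a)).
  have : generated (range x) a by rewrite genx.
  move/(_ [set a | S (quotient_proj V (fp_inl B a))]); apply; split.
    exact: pull (@fp_inlM A B).
  move=> _ [j _ <-] /=; have := Sgen (lshift m j).
  by rewrite /fp_gens -[lshift m j]/(unsplit (inl j)) unsplitK.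
have Sr b : S (quotient_proj V (fp_inr A b)).
  have : generated (range y) b by rewrite geny.
  move/(_ [set b | S (quotient_proj V (fp_inr A b))]); apply; split.
    exact: pull (@fp_inrM A B).
  move=> _ [j _ <-] /=; have := Sgen (rshift n j).
  by rewrite /fp_gens -[rshift n j]/(unsplit (inr j)) unsplitK.
rewrite -(fp_reprK (repr v)); elim: (repr (repr v)) => [|l s IHs].
  by rewrite -[fp_proj [::]]/(1 : P) (hom1 qM).
have -> : fp_proj (l :: s) = fp_proj [:: l] * fp_proj s by rewrite [RHS]fp_projM.
by rewrite qM; apply: SM => //; case: l.
Qed.

(** The kernel is an intersection: membership in W(P) is tested in [Q], membership in [A, B] by the
    two projections. The projected generators are 1 or generators of the factor, so [wp_nth] applies
    to them. *)
Lemma wp_verbal_product :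
  wp (nth 1 (codom x)) -> wp (nth 1 (codom y)) ->
  wp (nth 1 (codom (quotient_proj Q \o fp_gens))) ->
  wp (nth 1 (codom (quotient_proj V \o fp_gens))).
Proof.
move=> wpx wpy wpQ.
have wpA : wp (nth 1 (codom (@fp_fst A B \o fp_gens))).
  apply: wp_nth wpx => _ /codomP[i ->]; rewrite /= /fp_gens.
  case: (split i) => j; last by rewrite fp_fst_inr; apply: inspan1.
  by rewrite fp_fst_inl -nth_codom_ord; apply: inspan_gen.
have wpB : wp (nth 1 (codom (@fp_snd A B \o fp_gens))).
  apply: wp_nth wpy => _ /codomP[i ->]; rewrite /= /fp_gens.
  case: (split i) => j; first by rewrite fp_snd_inl; apply: inspan1.
  by rewrite fp_snd_inr -nth_codom_ord; apply: inspan_gen.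
have weE (C : groupType) (h : P -> C) (hM : {morph h : a b / a * b}) s :
    weval (nth 1 (codom (h \o fp_gens))) s = h (weval (nth 1 (codom fp_gens)) s).
  rewrite -(weval_hom hM); congr weval; apply/funext => k; exact: nth_codom_hom.
apply: eq_computable (computable_andb wpQ (computable_andb wpA wpB)) => s.
rewrite (weE _ _ (@quotient_proj_morph _ V)) (weE _ _ (@quotient_proj_morph _ Q)).
rewrite (weE _ _ (@fp_fstM A B)) (weE _ _ (@fp_sndM A B)).
apply/and3P/eqP => [[/eqP/quotient_proj_eq1 gQ /eqP gA /eqP gB]|].
  by apply/quotient_proj_eq1; split=> //; apply/cross_commutatorsP.
move=> /quotient_proj_eq1[gQ /cross_commutatorsP[gA gB]].
by split; apply/eqP => //; apply/quotient_proj_eq1.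
Qed.

End Main.
End Assembly.

Local Open Scope classical_set_scope.

Theorem theorem3p1 (A B : groupType) (W : set (word nat))
    (hA : decidable_word_problem A) (hB : decidable_word_problem B)
    (hW : (exists k : nat, (1 <= k)%N /\ W = [set nil_word k]) \/
          W = [set sol_word 2]) :
  decidable_word_problem (verbal_product W A B).
Proof.
have /decidable_word_problemP[n [x [genx wpx]]] := hA.
have /decidable_word_problemP[m [y [geny wpy]]] := hB.
apply/decidable_word_problemP.
exists (n + m), (quotient_proj (NormalSubgroup (@verbal_kernel_normal W A B)) \o fp_gens x y).
split; first exact: verbal_product_generated.
by apply: wp_verbal_product => //; apply: wp_verbal_quotient.
Qed.
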